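(* Consider smooth heaps and slim heaps with operations implemented as described in the context. Call a node temporary at a given time if it is deleted (by delete-min or delete) later in the operation sequence. For every finite sequence of operations, starting with no heaps, the total running time is $O\big(\sum_i c_i\big)$, where for the $i$-th operation, with $n_i$ the number of nodes of the heap at the time of the operation and $t_i$ the number of those nodes that are temporary at that time, $c_i = 1+\lg t_i$ if the operation is delete-min or delete, $c_i=\max(1,\lg\lg n_i)$ if it is decrease-key, and $c_i=1$ for make-heap, find-min, insert and meld. That is, delete-min and delete take $O(\lg t)$ amortized time, with the other amortized bounds ($O(\lg\lg n)$ for decrease-key, $O(1)$ for the rest) unchanged.
   Context: $\lg$ denotes the base-two logarithm. A heap stores a set of nodes, each with a real key, as a forest of rooted ordered trees in heap order (a child's key is at least its parent's key). The roots form a root list (identify front with ''left''), with a root of minimum key (the min-root) first; each node has an ordered list of children. A heap also has a buffer (a set of roots, initially empty), stores its number of nodes $n$, and maintains the minimum-key root among the buffer and among the root list. Key comparisons use the strict total order $\prec$: $a \prec b$ iff $\mathrm{key}(a)<\mathrm{key}(b)$, or the keys are equal and $a$ lies to the right of $b$ in the current list. A link of two nodes adjacent in a list (root list or sibling list) makes the $\prec$-smaller one (the winner) the parent of the other (the loser), removing the loser from the list; it is a left link if the loser was left of the winner, a right link otherwise. In a slim heap the loser always becomes the new leftmost child of the winner; in a smooth heap the loser becomes the new leftmost child after a left link and the new rightmost child after a right link. Each link costs $O(1)$ time. Leftmost locally maximum linking of a list: while more than one node remains, let $v$ be the leftmost node that is $\prec$-larger than each of its existing neighbours in the list, and link $v$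 with whichever existing neighbour is $\prec$-larger. Operations: make-heap creates an empty heap; find-min returns the minimum-key root (over root list and buffer); insert$(x,h)$ makes $x$ a one-node tree placed first in the root list if its key is smaller than the min-root's, second otherwise (no links); meld$(h,h')$ first empties the buffer of the heap with fewer nodes, then concatenates the root lists, keeps the buffer of the larger heap, and sets the min-root. Emptying a buffer: sort its roots in non-increasing key order (comparison sort), apply leftmost locally maximum linking to that sorted list, and add the resulting root to the root list. delete-min$(h)$: empty the buffer; delete the min-root $x$ and replace it in the root list by its children in their list order (so they precede the remaining roots); apply leftmost locally maximum linking to the whole root list until one root remains, which becomes the min-root. decrease-key$(x,k,h)$ (given a pointer to $x$ and $k \le \mathrm{key}(x)$): set $\mathrm{key}(x)=k$; if $x$ is not a root, cut $x$ (with its subtree) from its sibling list $L$, and if $x$ has a child, cut its leftmost child $y$ (with its subtree) from $x$ and put $y$ in $x$'s former place in $L$; then add $x$ to the buffer, and if the buffer contains at least $\lg n$ roots, empty it; finally update the minimum. delete$(x,h)$: if $x$ is the min-root, do delete-min; otherwise repeatedly link adjacent children of $x$ by leftmost locally maximum linking until $x$ has at most one child, and replace $x$ by that child (if any) in the list containing $x$. All operations other than links and buffer sorting take $O(1)$ time per elementary pointer step. *)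

(* Defs.v *)
From HB Require Import structures.
From mathcomp Require Import all_boot all_order all_algebra.
From mathcomp Require Import all_classical all_reals all_analysis.

Set Implicit Arguments.
Unset Strict Implicit.
Unset Printing Implicit Defensive.

Import Order.TTheory GRing.Theory Num.Theory.
Local Open Scope ring_scope.

Definition lg {R : realType} (x : R) : R := ln x / ln 2.

(* [Node x k cs] is the tree whose root is the node named [x], with key [k] and
   ordered list of children [cs]; the first element of a list is its leftmost
   one. *)
Inductive tree (R : Type) : Type := Node of nat & R & seq (tree R).

HB.instance Definition _ (R : Type) := gen_eqMixin (tree R).

Definition name {R : Type} (t : tree R) : nat := let: Node x _ _ := t in x.
Definition key {R : Type} (t : tree R) : R := let: Node _ k _ := t in k.
Definition children {R : Type} (t : tree R) : seq (tree R) :=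
  let: Node _ _ cs := t in cs.

Fixpoint subtrees {R : Type} (t : tree R) : seq (tree R) :=
  t :: flatten (map subtrees (children t)).

Definition names {R : Type} (l : seq (tree R)) : seq nat :=
  map name (flatten (map subtrees l)).

(* Replaces the subtree rooted at the node [x] by the list [f t], spliced into
   the place of that subtree in its sibling list (or in the list [l] itself
   if [x] is one of the roots). *)
Fixpoint tsplice {R : Type} (x : nat) (f : tree R -> seq (tree R)) (t : tree R) :
    seq (tree R) :=
  let: Node y k cs := t in
  if y == x then f t else [:: Node y k (flatten (map (tsplice x f) cs))].

Definition splice {R : Type} (x : nat) (f : tree R -> seq (tree R))
  (l : seq (tree R)) : seq (tree R) := flatten (map (tsplice x f) l).

Inductive variant := Slim | Smooth.

Definition nth_tree {R : realType} (l : seq (tree R)) (i : nat) : tree R :=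
  nth (Node 0 0 [::]) l i.

(* The strict total order on the nodes of a list [l], on positions. *)
Definition prec {R : realType} (l : seq (tree R)) (i j : nat) : bool :=
  (key (nth_tree l i) < key (nth_tree l j)) ||
  ((key (nth_tree l i) == key (nth_tree l j)) && (j < i)%N).

(* [win_left a b]: the loser [b] was to the left of the winner [a]. *)
Definition win_left {R : realType} (a b : tree R) : tree R :=
  let: Node x k cs := a in Node x k (b :: cs).

Definition win_right {R : realType} (v : variant) (a b : tree R) : tree R :=
  let: Node x k cs := a in
  Node x k (if v is Smooth then rcons cs b else b :: cs).

(* Links the nodes at positions [p] and [p.+1] of [l]. *)
Definition link {R : realType} (v : variant) (l : seq (tree R)) (p : nat) :
    seq (tree R) :=
  let a := nth_tree l p in
  let b := nth_tree l p.+1 in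
  take p l ++
  (if prec l p p.+1 then win_right v a b else win_left b a) :: drop p.+2 l.

Definition locally_max {R : realType} (l : seq (tree R)) (i : nat) : bool :=
  ((0 < i)%N ==> prec l i.-1 i) && ((i.+1 < size l)%N ==> prec l i.+1 i).

(* Links the leftmost locally maximum node with its larger neighbour. *)
Definition llm_step {R : realType} (v : variant) (l : seq (tree R)) :
    seq (tree R) :=
  let i := find (locally_max l) (iota 0 (size l)) in
  let right := (i.+1 < size l)%N && ((i == 0)%N || prec l i.-1 i.+1) in
  link v l (if right then i else i.-1).

(* Every link removes one node from the list, so that the iteration stops
   exactly when at most one node remains. *)
Definition llm {R : realType} (v : variant) (l : seq (tree R)) : seq (tree R) :=
  iter (size l).-1 (llm_step v) l.

(* One unit for each link, and one for each node of the list traversed. *)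
Definition llm_time {R : realType} (l : seq (tree R)) : R :=
  (size l + (size l).-1)%:R.

Record heap (R : Type) := Heap { roots : seq (tree R); buffer : seq (tree R) }.

Definition empty_heap (R : Type) : heap R := Heap [::] [::].
Definition nodes {R : Type} (H : heap R) : seq nat := names (roots H ++ buffer H).
Definition heap_size {R : Type} (H : heap R) : nat := size (nodes H).

Definition min_first {R : realType} (l : seq (tree R)) : bool :=
  if l is r :: l' then all (fun t => key r <= key t) l' else true.

(* [empty_buffer sort_time v H H' c]: emptying the buffer of [H] can result in
   [H'], in time [c].  The order [s] among roots with equal keys, and the
   position [p] at which the resulting root is added, are left open, except
   that a root of minimum key has to come first in the root list. *)
Inductive empty_buffer {R : realType} (sort_time : nat -> R) (v : variant) :
    heap R -> heap R -> R -> Prop :=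
| Empty_nothing rl :
    empty_buffer sort_time v (Heap rl [::]) (Heap rl [::]) 0
| Empty_roots rl b s r p :
    b <> [::] ->
    perm_eq s b -> sorted (fun t u => key u <= key t) s ->
    llm v s = [:: r] ->
    (p <= size rl)%N -> min_first (take p rl ++ r :: drop p rl) ->
    empty_buffer sort_time v (Heap rl b) (Heap (take p rl ++ r :: drop p rl) [::])
      (sort_time (size b) + llm_time s).

Definition insert {R : realType} (x : nat) (k : R) (H : heap R) : heap R :=
  let t := Node x k [::] in
  Heap (if roots H is r :: l then
          if k < key r then t :: r :: l else r :: t :: l
        else [:: t])
       (buffer H).

(* [H] has at most as many nodes as [H']. *)
Inductive meld {R : realType} (sort_time : nat -> R) (v : variant) :
    heap R -> heap R -> heap R -> R -> Prop :=
| Meld H H' H1 c rl :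
    (heap_size H <= heap_size H')%N ->
    empty_buffer sort_time v H H1 c ->
    rl = roots H1 ++ roots H' \/ rl = roots H' ++ roots H1 ->
    min_first rl ->
    meld sort_time v H H' (Heap rl (buffer H')) c.

(* Empties the buffer, replaces the root [x] of the root list by its children,
   and links the root list into a single tree. *)
Inductive delete_root {R : realType} (sort_time : nat -> R) (v : variant)
    (x : nat) : heap R -> heap R -> R -> Prop :=
| Delete_root H c l1 k cs l2 :
    empty_buffer sort_time v H (Heap (l1 ++ Node x k cs :: l2) [::]) c ->
    delete_root sort_time v x H (Heap (llm v (l1 ++ cs ++ l2)) [::])
      (c + llm_time (l1 ++ cs ++ l2)).

(* The min-root is the first root left in the root list by the emptying of the
   buffer. *)
Inductive delete_min {R : realType} (sort_time : nat -> R) (v : variant) :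
    nat -> heap R -> heap R -> R -> Prop :=
| Delete_min H c x k cs l :
    empty_buffer sort_time v H (Heap (Node x k cs :: l) [::]) c ->
    delete_min sort_time v x H (Heap (llm v (cs ++ l)) [::])
      (c + llm_time (cs ++ l)).

(* The part of decrease-key that precedes the test on the size of the buffer.
   A root stays in the list that contains it, except that a root of the root
   list whose new key is smaller than that of the min-root moves to the front. *)
Inductive cut {R : realType} (x : nat) (k : R) : heap R -> heap R -> Prop :=
| Cut_root l1 k0 cs l2 b :
    k <= k0 ->
    cut x k (Heap (l1 ++ Node x k0 cs :: l2) b)
      (Heap (if l1 is r :: _ then
               if k < key r then Node x k cs :: l1 ++ l2
               else l1 ++ Node x k cs :: l2
             else Node x k cs :: l2)
            b)
| Cut_buffer rl b1 k0 cs b2 :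
    k <= k0 ->
    cut x k (Heap rl (b1 ++ Node x k0 cs :: b2))
      (Heap rl (b1 ++ Node x k cs :: b2))
| Cut_nonroot rl b k0 cs :
    k <= k0 ->
    x \notin map name (rl ++ b) ->
    Node x k0 cs \in flatten (map subtrees (rl ++ b)) ->
    cut x k (Heap rl b)
      (Heap (splice x (fun t => take 1 (children t)) rl)
            (Node x k (behead cs) :: splice x (fun t => take 1 (children t)) b)).

Inductive decrease_key {R : realType} (sort_time : nat -> R) (v : variant)
    (x : nat) (k : R) : heap R -> heap R -> R -> Prop :=
| Decrease_key_keep H H1 :
    cut x k H H1 ->
    ((size (buffer H1))%:R : R) < lg (heap_size H1)%:R ->
    decrease_key sort_time v x k H H1 0
| Decrease_key_empty H H1 H2 c :
    cut x k H H1 ->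
    lg (heap_size H1)%:R <= (size (buffer H1))%:R :> R ->
    empty_buffer sort_time v H1 H2 c ->
    decrease_key sort_time v x k H H2 c.

Definition is_min_root {R : Type} (x : nat) (H : heap R) : bool :=
  if roots H is r :: _ then name r == x else false.

(* When [x] is the min-root, [delete_root] rather than [delete_min] ensures that
   [x] is the node removed even if a root that comes out of the buffer has
   taken its place at the front of the root list. *)
Inductive delete {R : realType} (sort_time : nat -> R) (v : variant) (x : nat) :
    heap R -> heap R -> R -> Prop :=
| Delete_min_root H H' c :
    is_min_root x H -> delete_root sort_time v x H H' c ->
    delete sort_time v x H H' c
| Delete_other rl b k cs :
    ~~ is_min_root x (Heap rl b) ->
    Node x k cs \in flatten (map subtrees (rl ++ b)) ->
    delete sort_time v x (Heap rl b)
      (Heap (splice x (fun t => llm v (children t)) rl)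
            (splice x (fun t => llm v (children t)) b))
      (llm_time cs).

(* Heaps are designated by natural numbers; [used] lists the nodes inserted so
   far, so that every insertion is that of a new node. *)
Record state (R : Type) :=
  State { heaps : nat -> option (heap R); used : seq nat }.

Definition no_heaps (R : Type) : state R := State (fun=> None) [::].

Definition set_heap {R : Type} (st : state R) (h : nat) (oH : option (heap R)) :
    state R :=
  State [eta heaps st with h |-> oH] (used st).

Inductive operation (R : Type) :=
| MakeHeap (h : nat)
| FindMin (h : nat)
| Insert (x : nat) (k : R) (h : nat)
| Meld_into (h h' : nat)
| DeleteMin (h : nat)
| DecreaseKey (x : nat) (k : R) (h : nat)
| Delete (x h : nat).

Arguments MakeHeap {R} h.
Arguments FindMin {R} h.
Arguments Meld_into {R} h h'.
Arguments DeleteMin {R} h.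
Arguments Delete {R} x h.

(* [step sort_time v st o d c st']: in the state [st], the operation [o] can
   lead to the state [st'] in time [c]; [d] is the node that it deletes, if
   any.  Each operation is charged one unit for the bounded number of
   elementary steps other than links, list traversals and buffer sorting;
   this includes the maintenance of the minimum. *)
Inductive step {R : realType} (sort_time : nat -> R) (v : variant) (st : state R) :
    operation R -> option nat -> R -> state R -> Prop :=
| Step_make_heap h :
    heaps st h = None ->
    step sort_time v st (MakeHeap h) None 1 (set_heap st h (Some (empty_heap R)))
| Step_find_min h H :
    heaps st h = Some H ->
    step sort_time v st (FindMin h) None 1 st
| Step_insert x k h H :
    heaps st h = Some H -> x \notin used st ->
    step sort_time v st (Insert x k h) None 1
      (State (heaps (set_heap st h (Some (insert x k H)))) (x :: used st))
| Step_meld h h' H H' H'' c :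
    h <> h' -> heaps st h = Some H -> heaps st h' = Some H' ->
    meld sort_time v H H' H'' c \/ meld sort_time v H' H H'' c ->
    step sort_time v st (Meld_into h h') None (1 + c)
      (set_heap (set_heap st h' None) h (Some H''))
| Step_delete_min h H x H' c :
    heaps st h = Some H -> delete_min sort_time v x H H' c ->
    step sort_time v st (DeleteMin h) (Some x) (1 + c) (set_heap st h (Some H'))
| Step_decrease_key x k h H H' c :
    heaps st h = Some H -> decrease_key sort_time v x k H H' c ->
    step sort_time v st (DecreaseKey x k h) None (1 + c)
      (set_heap st h (Some H'))
| Step_delete x h H H' c :
    heaps st h = Some H -> delete sort_time v x H H' c ->
    step sort_time v st (Delete x h) (Some x) (1 + c) (set_heap st h (Some H')).

(* The record of one operation in an execution: the state before it, the
   operation, the node that it deletes, and its running time. *)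
Record event (R : Type) := Event {
  before : state R; op : operation R; deleted : option nat; time : R }.

Inductive run {R : realType} (sort_time : nat -> R) (v : variant) :
    state R -> seq (event R) -> Prop :=
| Run_nil st : run sort_time v st [::]
| Run_cons st o d c st' es :
    step sort_time v st o d c st' -> run sort_time v st' es ->
    run sort_time v st (Event st o d c :: es).

Definition nodes_of {R : Type} (st : state R) (h : nat) : seq nat :=
  if heaps st h is Some H then nodes H else [::].

(* The number of temporary nodes of the heap [h] at the beginning of the
   execution [es].  The node deleted by the first operation of [es] counts as
   temporary, so that this number is positive when that operation deletes a
   node of [h]. *)
Definition temporaries {R : Type} (st : state R) (h : nat) (es : seq (event R)) :
    nat :=
  count (mem (pmap (@deleted R) es)) (nodes_of st h).

Definition amortized {R : realType} (e : event R) (es : seq (event R)) : R :=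
  match op e with
  | DeleteMin h | Delete _ h => 1 + lg (temporaries (before e) h (e :: es))%:R
  | DecreaseKey _ _ h => Num.max 1 (lg (lg (size (nodes_of (before e) h))%:R))
  | MakeHeap _ | FindMin _ | Insert _ _ _ | Meld_into _ _ => 1
  end.

Fixpoint total_amortized {R : realType} (es : seq (event R)) : R :=
  if es is e :: es' then amortized e es' + total_amortized es' else 0.

Definition total_time {R : realType} (es : seq (event R)) : R :=
  \sum_(e <- es) time e.

(* Main.v *)
(* Charge every node the logarithm of the number of temporary nodes in its
   subtree and in those of some of its siblings: the siblings between it and the
   place in the list of children where those won by left links meet those won by
   right links.  The first two children of a node, and the last one on the
   right side, are not charged.

   These charges are monotone in the sizes of subtrees, so that a cut does not
   increase those that remain.  A decrease-key takes away the first child of the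
   node that it cuts, and the emptying of the buffer, which links a chain, gives
   the node a new first child: neither changes the charges of its other children.

   Leftmost locally maximum linking builds a Cartesian tree, so that each node wins
   at most one left and one right link, and between two nodes that win both there is
   one that wins none.  Each link won costs at most the logarithm of the weight of the
   winner; compared by partial summation with the charges of the deleted node's
   children, this leaves one unit for each temporary winner, up to O(lg t).  A
   loser whose winner is permanent is never exposed again by a deletion, and pays
   for itself.

   Each root of the root list that has temporary descendants is charged 3 lg(t+1),
   and -3 t lg(t+1) is added.
   So the logarithm that a temporary node receives when it is inserted is repaid
   when it is deleted, and melding is free because t lg(t+1) is superadditive.
   The potential is nonnegative in the end, since no temporary node is left. *)

From mathcomp Require Import all_boot all_order all_algebra.
From mathcomp Require Import all_classical all_reals all_analysis.
From mathcomp Require Import zify lra.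
Require Import Defs.

Set Implicit Arguments.
Unset Strict Implicit.
Unset Printing Implicit Defensive.

Import Order.TTheory GRing.Theory Num.Theory.
Local Open Scope ring_scope.

(** * Binary logarithms of natural numbers *)

Section Logs.
Context {R : realType}.

(** The shift gives the value 0 at weight 0 and at least 1 at every positive weight. *)
Definition lgS (n : nat) : R := lg n.+1%:R.

Lemma ln2_ge : 2^-1 <= ln 2 :> R.
Proof.
have h : ln (1 + - 2^-1) <= - 2^-1 :> R by apply: le_ln1Dx; lra.
have e : 1 + - 2^-1 = 2^-1 :> R by lra.
rewrite e lnV ?posrE in h; lra.
Qed.

Lemma ln2_gt0 : 0 < ln 2 :> R.
Proof. by have := ln2_ge; lra. Qed.

Lemma lg_le (x y : R) : 0 < x -> x <= y -> lg x <= lg y.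
Proof.
move=> x0 xy; rewrite /lg ler_pM2r ?invr_gt0 ?ln2_gt0 //.
by rewrite ler_ln ?posrE //; lra.
Qed.

Lemma lgM (x y : R) : 0 < x -> 0 < y -> lg (x * y) = lg x + lg y.
Proof. by move=> x0 y0; rewrite /lg lnM ?posrE // mulrDl. Qed.

Lemma lg2 : lg (2 : R) = 1.
Proof. by rewrite /lg divff // gt_eqF ?ln2_gt0. Qed.

Lemma lg_nat_le (m n : nat) : (m <= n)%N -> lg (m%:R : R) <= lg (n%:R : R).
Proof.
case: m => [|m] mn; last by apply: lg_le; rewrite ?ltr0n // ler_nat.
rewrite {1}/lg ln0 // mul0r /lg; apply: divr_ge0; last exact: ltW ln2_gt0.
by case: n mn => [|n] _; [rewrite ln0|rewrite ln_ge0 // (ler_nat R 1)].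
Qed.

Lemma lg_nat_ge0 (n : nat) : 0 <= lg (n%:R : R).
Proof. by have := lg_nat_le (leq0n n); rewrite {1}/lg ln0 // mul0r. Qed.

Lemma lgX2 n : lg ((2 ^ n)%:R : R) = n%:R.
Proof.
by rewrite natrX /lg lnXn // mulrnAl divff // gt_eqF ?ln2_gt0.
Qed.

Lemma lgS0 : lgS 0 = 0.
Proof. by rewrite /lgS /lg ln1 mul0r. Qed.

Lemma lgS1 : lgS 1 = 1.
Proof. by rewrite /lgS lg2. Qed.

Lemma lgS_le m n : (m <= n)%N -> lgS m <= lgS n.
Proof. by move=> mn; rewrite /lgS lg_le ?ltr0n // ler_nat. Qed.

Lemma lgS_ge0 n : 0 <= lgS n.
Proof. by rewrite -lgS0 lgS_le. Qed.

Lemma lgS_ge1 n : (0 < n)%N -> 1 <= lgS n.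
Proof. by move=> n0; rewrite -lgS1 lgS_le. Qed.

(** For positive [s], the square of [s + n + 1] is at least [2 * (s + 1) * (n + 1)]. The unit gained
    here is what pays for a winner of positive weight. *)
Lemma lgS_add s n : (0 < s)%N -> 1 + lgS s + lgS n <= lgS (s + n) + lgS (s + n).
Proof.
move=> s0; rewrite -lg2 /lgS -!lgM ?mulr_gt0 ?ltr0n // -!natrM.
by rewrite lg_le ?ltr0n ?muln_gt0 // ler_nat; nia.
Qed.

Lemma lgSD m n : lgS (m + n) <= lgS m + lgS n.
Proof.
rewrite /lgS -lgM ?ltr0n // -natrM lg_le ?ltr0n // ler_nat; nia.
Qed.

Lemma lgS_le_id n : lgS n <= n%:R.
Proof. by rewrite -lgX2 lg_le ?ltr0n // ler_nat ltn_expl. Qed.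

Lemma lgS_double m n : (m <= n)%N -> lgS (m + n) <= lgS n + 1.
Proof.
move=> mn; rewrite -[X in _ <= _ + X]lg2 /lgS -lgM ?ltr0n // -natrM lg_le ?ltr0n //.
by rewrite ler_nat; lia.
Qed.

Lemma lgS_lg n : (0 < n)%N -> lgS n <= 1 + lg (n%:R : R).
Proof.
by move=> n0; rewrite -[X in _ <= X + _]lg2 /lgS -lgM ?ltr0n // -natrM lg_le ?ltr0n // ler_nat; lia.
Qed.

Lemma lg_le_lgS n : lg (n%:R : R) <= lgS n.
Proof.
case: n => [|n]; first by rewrite lgS0 /lg ln0 ?mul0r.
by rewrite lg_le ?ltr0n // ler_nat.
Qed.

(** The increment is [lgS n.+1] plus [n * lg (1 + 1 / (n + 1))]. The latter is at most [1 / ln 2],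
    hence at most 2 by [ln2_ge]. *)
Lemma lgS_step n : n.+1%:R * lgS n.+1 <= n%:R * lgS n + lgS n.+1 + 2.
Proof.
have e : lgS n.+1 = lgS n + lg (1 + n.+1%:R^-1 : R).
  rewrite /lgS -lgM ?addr_gt0 ?invr_gt0 ?ltr0n //; congr lg.
  by rewrite mulrDr mulr1 divff ?pnatr_eq0 // -natr1.
have ipos : 0 < n.+1%:R^-1 :> R by rewrite invr_gt0 ltr0n.
have h : lg (1 + n.+1%:R^-1) <= 2 * n.+1%:R^-1 :> R.
  rewrite /lg ler_pdivrMr ?ln2_gt0 //.
  apply: (@le_trans _ _ n.+1%:R^-1); first by apply: le_ln1Dx; apply: lt_trans ipos; rewrite ltrN10.
  by rewrite mulrAC; have := ln2_ge; set i := n.+1%:R^-1 in ipos *; nra.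
have nle : n%:R * n.+1%:R^-1 <= 1 :> R.
  by rewrite ler_pdivrMr ?ltr0n // mul1r ler_nat.
have n0 : 0 <= n%:R :> R by [].
have key : n%:R * lg (1 + n.+1%:R^-1) <= 2 :> R.
  by apply: le_trans (ler_wpM2l n0 h) _; rewrite mulrCA ger_pMr.
have -> : n.+1%:R * lgS n.+1 = n%:R * lgS n.+1 + lgS n.+1 by rewrite -natr1 mulrDl mul1r.
have -> : n%:R * lgS n.+1 = n%:R * lgS n + n%:R * lg (1 + n.+1%:R^-1) by rewrite e mulrDr.
lra.
Qed.

End Logs.

(** * The charge determined by the weights of a list of children *)

Section Spread.
Context {R : realType}.
Implicit Types (z a b : seq nat).

(** Each entry is charged for the whole suffix that it begins, itself included. *)
Fixpoint suf z : R := if z is x :: z' then lgS (sumn z) + suf z' else 0.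

(* [a] and [b] are the weights of the children on the two sides of the meeting
   place; the last child on the right side is not charged. *)
Definition split_cost a b : R := suf a + suf (behead (rev b)).

(* The meeting place is not recorded in the tree: take the best one. *)
Definition spread z : R :=
  \big[Order.min/suf z]_(i < (size z).+1) split_cost (take i z) (drop i z).

Lemma suf_ge0 z : 0 <= suf z.
Proof. by elim: z => //= x z IH; rewrite addr_ge0 ?lgS_ge0. Qed.

Lemma spread_le a b : spread (a ++ b) <= split_cost a b.
Proof.
have h : (size a < (size (a ++ b)).+1)%N by rewrite size_cat ltnS leq_addr.
rewrite /spread; apply: (@bigmin_inf _ _ _ _ (Ordinal h)) => //=.
by rewrite take_size_cat // drop_size_cat.
Qed.

Lemma spread_split z : exists a b, z = a ++ b /\ spread z = split_cost a b.
Proof.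
suff [a [b [zab le]]] : exists a b, z = a ++ b /\ split_cost a b <= spread z.
  exists a, b; split=> //; apply/le_anti; rewrite le andbT.
  by rewrite zab spread_le.
have : spread z <= spread z by [].
rewrite {1}/spread => /bigmin_leP [le|[i _ le]].
  (* The default value of the minimum is the split with nothing on the right. *)
  exists z, [::]; rewrite cats0; split=> //.
  by apply: le_trans le; rewrite /split_cost /= addr0.
by exists (take i z), (drop i z); rewrite cat_take_drop.
Qed.

Lemma spread_ge0 z : 0 <= spread z.
Proof.
by have [a [b [_ ->]]] := spread_split z; rewrite addr_ge0 ?suf_ge0.
Qed.

Lemma spread_nil : spread [::] = 0.
Proof.
by apply/le_anti; rewrite spread_ge0 (le_trans (@spread_le [::] [::])) // /split_cost /= addr0.
Qed.

(* [shrunk z' z]: [z'] comes from [z] by deleting and decreasing entries. *)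
Fixpoint shrunk z' z : Prop :=
  match z with
  | [::] => z' = [::]
  | x :: z1 =>
      shrunk z' z1 \/ exists y z1', [/\ z' = y :: z1', (y <= x)%N & shrunk z1' z1]
  end.

Lemma shrunk_refl z : shrunk z z.
Proof. by elim: z => //= x z IH; right; exists x, z. Qed.

Lemma shrunk_sumn z' z : shrunk z' z -> (sumn z' <= sumn z)%N.
Proof.
elim: z z' => [|x z IH] z' /= => [->//|[/IH h|[y [z1 [-> yx /IH h]]]]] /=; lia.
Qed.

Lemma shrunk_cat a' a b' b : shrunk a' a -> shrunk b' b -> shrunk (a' ++ b') (a ++ b).
Proof.
move=> + hb; elim: a a' => [|x a IH] a' /= => [->//|[/IH h|[y [z1 [-> yx /IH h]]]]].
  by left.
by right; exists y, (z1 ++ b').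
Qed.

Lemma shrunk_rev z' z : shrunk z' z -> shrunk (rev z') (rev z).
Proof.
elim: z z' => [|x z IH] z' /= => [->//|[/IH h|[y [z1 [-> yx /IH h]]]]].
  by rewrite rev_cons -cats1 -[rev z']cats0; apply: shrunk_cat => //=; left.
by rewrite !rev_cons -!cats1; apply: shrunk_cat => //=; right; exists y, [::].
Qed.

Lemma shrunk_behead_l z' z : shrunk z' z -> shrunk (behead z') z.
Proof.
elim: z z' => [|x z IH] z' /= => [->//|[/IH h|[y [z1 [-> _ h]]]]]; by left.
Qed.

Lemma shrunk_behead z' z : shrunk z' z -> shrunk (behead z') (behead z).
Proof.
by case: z => [|x z] /= => [->//|[/shrunk_behead_l//|[y [z1 [-> _ h]]]]].
Qed.

Lemma shrunk_drop d z' z : shrunk z' z -> shrunk (drop d z') (drop d z).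
Proof.
by elim: d z' z => [|d IH] z' z h; rewrite ?drop0 // -addn1 -!drop_drop !drop1;
  apply: IH; apply: shrunk_behead.
Qed.

Lemma shrunk_cat_inv z' a b :
  shrunk z' (a ++ b) -> exists a' b', [/\ z' = a' ++ b', shrunk a' a & shrunk b' b].
Proof.
elim: a z' => [|x a IH] z' /= h; first by exists [::], z'.
case: h => [/IH [a' [b' [-> ha hb]]]|[y [z1 [-> yx /IH [a' [b' [-> ha hb]]]]]]].
  by exists a', b'; split=> //; left.
by exists (y :: a'), b'; split=> //=; right; exists y, a'.
Qed.

Lemma suf_shrunk z' z : shrunk z' z -> suf z' <= suf z.
Proof.
elim: z z' => [|x z IH] z' /= => [->//|[/IH h|[y [z1 [-> yx h]]]]].
  by rewrite (le_trans h) // lerDr lgS_ge0.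
by rewrite /= lerD ?IH // lgS_le // leq_add // shrunk_sumn.
Qed.

(** The best split of [z] restricts to a split of [z'] whose two sides are shrunk too, and the best
    split of [z'] can only be cheaper. *)
Lemma spread_shrunk z' z : shrunk z' z -> spread z' <= spread z.
Proof.
have [a [b [-> ->]]] := spread_split z => /shrunk_cat_inv [a' [b' [-> ha hb]]].
apply: le_trans (spread_le a' b') _.
by rewrite lerD ?suf_shrunk //; apply: shrunk_behead; apply: shrunk_rev.
Qed.

Lemma spread_cons x z : spread (x :: z) <= lgS (x + sumn z) + spread z.
Proof.
have [a [b [-> ->]]] := spread_split z.
apply: le_trans (spread_le (x :: a) b) _.
by rewrite /split_cost /= addrA !lerD // lgS_le // leq_add2l sumn_cat leq_addr.
Qed.

Lemma suf_rev_behead b : suf (rev b) <= lgS (sumn b) + suf (behead (rev b)).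
Proof.
rewrite -sumn_rev; case: (rev b) => [|x b'] //=.
by rewrite addr_ge0 ?lgS_ge0.
Qed.

(** The new entry takes the free place at the right end, so only the former last entry starts to be
    charged, for the sum of the old right side. The weight of the new entry does not matter: a link
    costs the weight of its winner alone. *)
Lemma spread_rcons x z : spread (rcons z x) <= lgS (sumn z) + spread z.
Proof.
have [a [b [-> ->]]] := spread_split z.
rewrite rcons_cat; apply: le_trans (spread_le a (rcons b x)) _.
rewrite /split_cost rev_rcons /=.
have := suf_rev_behead b.
have : lgS (sumn b) <= lgS (sumn (a ++ b)) :> R by rewrite lgS_le // sumn_cat leq_addl.
lra.
Qed.

Lemma spread_drop d z : spread (drop d z) <= spread (drop d.+1 z) + lgS (sumn z).
Proof.
rewrite -add1n -drop_drop drop1.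
have : (sumn (drop d z) <= sumn z)%N by rewrite -{2}(cat_take_drop d z) sumn_cat leq_addl.
case: (drop d z) => [|x z'] /= h; first by rewrite spread_nil addr_ge0 ?spread_ge0 ?lgS_ge0.
by have := spread_cons x z'; have := @lgS_le R _ _ h; lra.
Qed.

(* Each new child in front pushes one child out of the two free positions, and
   each new child at the end makes one inner prefix count. *)
Lemma spread_win pre z post :
  (size post <= 1)%N -> (size pre + size post <= 2)%N ->
  spread (drop 2 (pre ++ z ++ post)) <=
    spread (drop 2 z) + (size pre + size post)%:R * lgS (sumn z).
Proof.
have rc d (x : nat) : spread (drop d (rcons z x)) <= spread (drop d z) + lgS (sumn z).
  have L0 : 0 <= spread (drop d z) + lgS (sumn z) :> R.
    by rewrite addr_ge0 ?spread_ge0 ?lgS_ge0.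
  have [dz|dz] := leqP d (size z); last by rewrite drop_oversize ?spread_nil // size_rcons.
  have h : (sumn (drop d z) <= sumn z)%N by rewrite -{2}(cat_take_drop d z) sumn_cat leq_addl.
  by rewrite drop_rcons //; have := spread_rcons x (drop d z); have := @lgS_le R _ _ h; lra.
have L0 := @lgS_ge0 R (sumn z).
have D0 := spread_drop 0 z; rewrite drop0 in D0.
have D1 := spread_drop 1 z.
case: post => [|y [|//]] _; case: pre => [|x [|x' [|//]]] //= _; rewrite ?cats0 ?cats1 ?drop0.
- by rewrite mul0r addr0.
- by rewrite mul1r.
- by lra.
- by rewrite mul1r.
- by have := rc 1 y; lra.
Qed.

(** Three children are exempt from the charge, two in front and one at the right end; charging them
    as well costs [lgS (sumn z)] each. *)
Lemma suf_le_spread z :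
  exists a b, z = a ++ b /\
    suf a + suf (rev b) <= spread (drop 2 z) + 3 * lgS (sumn z).
Proof.
have [a [b [e ->]]] := spread_split (drop 2 z).
have L0 := @lgS_ge0 R (sumn z).
have hb := suf_rev_behead b.
have sab : (sumn a + sumn b <= sumn z)%N.
  by rewrite -sumn_cat -e -{2}(cat_take_drop 2 z) sumn_cat leq_addl.
have hb' : lgS (sumn b) <= lgS (sumn z) :> R by rewrite lgS_le; lia.
exists (take 2 z ++ a), b; rewrite -catA -e cat_take_drop; split=> //.
rewrite /split_cost.
suff : suf (take 2 z ++ a) <= suf a + 2 * lgS (sumn z) by lra.
have : (sumn (take 2 z) + sumn a <= sumn z)%N.
  by rewrite -{2}(cat_take_drop 2 z) sumn_cat e sumn_cat; lia.
case: z {e hb' sab} L0 => [|x [|y z]] /= L0 h; rewrite ?take0 /=.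
- by rewrite ?cats0; lra.
- have : lgS (x + sumn a) <= lgS (x + 0) :> R by rewrite lgS_le; lia.
  lra.
- rewrite take0 /= in h *.
  have : lgS (x + (y + sumn a)) <= lgS (x + (y + sumn z)) :> R by rewrite lgS_le; lia.
  have : lgS (y + sumn a) <= lgS (x + (y + sumn z)) :> R by rewrite lgS_le; lia.
  lra.
Qed.

(* [q] lists the weight of each node of a list and the number of links that it
   wins.  For [0 < s] one has [1 + lgS s + lgS n <= 2 * lgS (s + n)], with [n]
   the weight of what follows the node. *)
Lemma suf_wins (e : nat) (q : seq (nat * nat)) :
  (forall i, (i <= size q)%N -> (sumn (unzip2 (take i q)) <= e + i)%N) ->
  \sum_(p <- q) (p.2%:R * lgS p.1 + ((0 < p.1) && (0 < p.2))%N%:R) <=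
    suf (unzip1 q) + e.+1%:R * lgS (sumn (unzip1 q)).
Proof.
elim: q e => [|[s w] q IH] e h; first by rewrite big_nil /= lgS0 mulr0 addr0.
rewrite big_cons /=.
have we : (w <= e.+1)%N by have := h 1%N isT; rewrite /= take0 /=; lia.
(* The excess [e] bounds the wins beyond one per node. The first node adds one to this allowance and
   uses up [w]. *)
have {IH} := IH (e.+1 - w)%N.
set n := sumn (unzip1 q) => IH.
have {IH} IH : \sum_(p <- q) (p.2%:R * lgS p.1 + ((0 < p.1) && (0 < p.2))%N%:R) <=
    suf (unzip1 q) + (e.+1 - w).+1%:R * lgS n.
  by apply: IH => i iq; have := h i.+1 iq; rewrite /=; lia.
suff : w%:R * lgS s + ((0 < s) && (0 < w))%N%:R + (e.+1 - w).+1%:R * lgS n <=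
       lgS (s + n) + e.+1%:R * lgS (s + n) :> R by lra.
have L1 : lgS s <= lgS (s + n) :> R by rewrite lgS_le // leq_addr.
have L2 : lgS n <= lgS (s + n) :> R by rewrite lgS_le // leq_addl.
have := @lgS_ge0 R s; have := @lgS_ge0 R n.
set x := lgS s in L1 *; set y := lgS n in L2 *; set u := lgS (s + n) in L1 L2 * => y0 x0.
have [w0|w0] := posnP w.
  rewrite w0 andbF subn0 mul0r !add0r -natr1 mulrDl mul1r addrC lerD //.
  by rewrite ler_wpM2l.
have [s0|s0] := posnP s; rewrite ?w0 /=.
  have -> : x = 0 by rewrite /x s0 lgS0.
  have c : (e.+1 - w).+1%:R <= e.+1%:R :> R by rewrite ler_nat; lia.
  have := ler_wpM2r y0 c; have : e.+1%:R * y <= e.+1%:R * u by rewrite ler_wpM2l.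
  rewrite mulr0 /=; lra.
(* One win of the node, one copy of [y] and the unit are paid by two copies of [u]; the other [e]
   terms are bounded by [u] one at a time. *)
have hs : 1 + x + y <= u + u := lgS_add n s0.
have -> : w%:R = w.-1%:R + 1 :> R by rewrite natr1 prednK.
have -> : (e.+1 - w).+1%:R = (e.+1 - w)%:R + 1 :> R by rewrite natr1.
have -> : e.+1%:R = w.-1%:R + (e.+1 - w)%:R + 1 :> R.
  by rewrite -natrD natr1; congr _%:R; lia.
have A : w.-1%:R * x <= w.-1%:R * u by rewrite ler_wpM2l.
have B : (e.+1 - w)%:R * y <= (e.+1 - w)%:R * u by rewrite ler_wpM2l.
lra.
Qed.

End Spread.

(** * Weights, charges and degrees in a forest *)

Section Forests.
Context {R : realType}.
Implicit Types (t u : tree R) (l : seq (tree R)) (tmp : pred nat).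

Lemma tree_ind_in (P : tree R -> Prop) :
  (forall x k cs, (forall c, c \in cs -> P c) -> P (Node x k cs)) -> forall t, P t.
Proof.
move=> h; fix IH 1 => -[x k cs]; apply: h.
elim: cs => [|c cs IHcs]; first by clear IH => d; rewrite in_nil.
move: (IH c) => Pc; clear IH => d.
by rewrite in_cons => /orP [/eqP ->|]; [exact: Pc|exact: IHcs].
Qed.

Definition all_subtrees l : seq (tree R) := flatten (map subtrees l).

Lemma all_subtrees_cons t l :
  all_subtrees (t :: l) = t :: all_subtrees (children t) ++ all_subtrees l.
Proof. by case: t. Qed.

Lemma all_subtrees_cat l1 l2 :
  all_subtrees (l1 ++ l2) = all_subtrees l1 ++ all_subtrees l2.
Proof. by rewrite /all_subtrees map_cat flatten_cat. Qed.

Lemma names_cons t l : names (t :: l) = name t :: names (children t) ++ names l.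
Proof. by rewrite /names -/(all_subtrees _) all_subtrees_cons /= map_cat. Qed.

Lemma names_cat l1 l2 : names (l1 ++ l2) = names l1 ++ names l2.
Proof. by rewrite /names -/(all_subtrees _) all_subtrees_cat map_cat. Qed.

Definition wt tmp l : nat := count tmp (names l).
Definition twt tmp t : nat := wt tmp [:: t].

Lemma wt_cat tmp l1 l2 : wt tmp (l1 ++ l2) = (wt tmp l1 + wt tmp l2)%N.
Proof. by rewrite /wt names_cat count_cat. Qed.

Lemma wt_cons tmp t l : wt tmp (t :: l) = (twt tmp t + wt tmp l)%N.
Proof. by rewrite -cat1s wt_cat. Qed.

Lemma twtE tmp t : twt tmp t = (tmp (name t) + wt tmp (children t))%N.
Proof. by rewrite /twt /wt names_cons /= cats0. Qed.

Lemma sumn_twt tmp l : sumn (map (twt tmp) l) = wt tmp l.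
Proof. by elim: l => //= t l ->; rewrite wt_cons. Qed.

(* [d = 2], except for a root of the buffer, which is about to receive a new first
   child and has [d = 1]. *)
Definition level d tmp t : R := spread (drop d (map (twt tmp) (children t))).
Definition pot tmp l : R := \sum_(t <- all_subtrees l) level 2 tmp t.
(** Pays for traversing and linking the children of a node when it is deleted, hence only temporary
    nodes contribute. *)
Definition deg tmp l : nat := \sum_(t <- all_subtrees l) tmp (name t) * size (children t).

Lemma level_ge0 d tmp t : 0 <= level d tmp t.
Proof. exact: spread_ge0. Qed.

Lemma pot_ge0 tmp l : 0 <= pot tmp l.
Proof. by apply: sumr_ge0 => t _; exact: level_ge0. Qed.

Lemma pot_nil tmp : pot tmp [::] = 0.
Proof. by rewrite /pot big_nil. Qed.

Lemma pot_cat tmp l1 l2 : pot tmp (l1 ++ l2) = pot tmp l1 + pot tmp l2.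
Proof. by rewrite /pot all_subtrees_cat big_cat. Qed.

Lemma pot_cons tmp t l :
  pot tmp (t :: l) = level 2 tmp t + pot tmp (children t) + pot tmp l.
Proof. by rewrite /pot all_subtrees_cons big_cons big_cat addrA. Qed.

Lemma deg_nil tmp : deg tmp [::] = 0%N.
Proof. by rewrite /deg big_nil. Qed.

Lemma deg_cat tmp l1 l2 : deg tmp (l1 ++ l2) = (deg tmp l1 + deg tmp l2)%N.
Proof. by rewrite /deg all_subtrees_cat big_cat. Qed.

Lemma deg_cons tmp t l :
  deg tmp (t :: l) = (tmp (name t) * size (children t) + deg tmp (children t) + deg tmp l)%N.
Proof. by rewrite /deg all_subtrees_cons big_cons big_cat addnA. Qed.

End Forests.

(* The winners of the links of a list, as a binary tree whose inorder traversal is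
   the list: the left (right) subtree of a node represents the loser of the left
   (right) link that it wins. *)
Inductive bintree (A : Type) := Leaf | Bin of bintree A & A & bintree A.
Arguments Leaf {A}.

(** * Cartesian trees of links and what the links cost *)

Section Linking.
Context {R : realType}.
Implicit Types (t u : tree R) (l : seq (tree R)) (tmp : pred nat) (v : variant).

Definition is_bin A (B : bintree A) : bool := if B is Bin _ _ _ then true else false.
Definition has_left A (B : bintree A) : bool := if B is Bin l _ _ then is_bin l else false.
Definition has_right A (B : bintree A) : bool := if B is Bin _ _ r then is_bin r else false.

Fixpoint inorder A (B : bintree A) : seq (A * nat) :=
  if B is Bin l a r then inorder l ++ (a, is_bin l + is_bin r)%N :: inorder r else [::].

Lemma cat_eq_cat A (a b c d : seq A) : a ++ b = c ++ d ->
  (exists m, a = c ++ m /\ d = m ++ b) \/ (exists m, c = a ++ m /\ b = m ++ d).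
Proof.
elim: a c => [|x a IH] [|y c] /= E.
- by left; exists [::].
- by right; exists (y :: c).
- by left; exists (x :: a).
- by case: E => -> /IH [[m [-> ->]]|[m [-> ->]]]; [left|right]; exists m.
Qed.

Definition wins A (B : bintree A) : seq nat := unzip2 (inorder B).

(** The induction also needs that a whole nonempty tree has one win fewer than it has nodes, and
    that a prefix or a suffix has at most as many wins as nodes. An infix across the root is a
    suffix of the left part, the root with at most two wins, and a prefix of the right part. *)
Lemma wins_infix A (B : bintree A) x y z : wins B = x ++ y ++ z -> (sumn y <= (size y).+1)%N.
Proof.
suff H : forall B : bintree A,
   [/\ (sumn (wins B) + is_bin B = size (wins B))%N,
       (forall x y, wins B = x ++ y -> sumn x <= size x /\ sumn y <= size y)%N &
       (forall x y z, wins B = x ++ y ++ z -> sumn y <= (size y).+1)%N].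
  by have [_ _ h] := H B; apply: h.
clear; elim=> [|l [Sl Pl Il] a r [Sr Pr Ir]] /=.
  by split=> // [x y|x y z]; case: x => //; case: y.
have -> : wins (Bin l a r) = wins l ++ (is_bin l + is_bin r)%N :: wins r.
  by rewrite /wins /unzip2 /= map_cat.
set w := (is_bin l + is_bin r)%N.
have split2 (s x y : seq nat) : s ++ w :: wins r = x ++ y ->
    (exists m, s = x ++ m /\ y = m ++ w :: wins r) \/
    (exists m, x = s ++ w :: m /\ wins r = m ++ y).
  move=> /cat_eq_cat [|[[|w' m] [-> E]]]; first by left.
  - by left; exists [::]; rewrite !cats0.
  - by case: E => <- ->; right; exists m.
have wl : (is_bin l <= 1)%N by case: (is_bin l).
have wr : (is_bin r <= 1)%N by case: (is_bin r).
have Pre x y : wins l ++ w :: wins r = x ++ y -> (sumn x <= size x)%N.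
  move=> /split2 [[m [/Pl[] //]]|[m [-> /Pr [h _]]]].
  rewrite sumn_cat size_cat /= /w; lia.
have Suf x y : wins l ++ w :: wins r = x ++ y -> (sumn y <= size y)%N.
  move=> /split2 [[m [/Pl[_ h] ->]]|[m [_ /Pr []//]]].
  rewrite sumn_cat size_cat /= /w; lia.
split; first (rewrite sumn_cat size_cat /= /w; lia).
  by move=> x y E; split; [exact: Pre E|exact: Suf E].
move=> x y z E; have [[m [El Ez]]|[m [_ Er]]] := split2 _ _ _ E; last exact: Ir Er.
have [[m' [Em _]]|[m' [-> Er]]] := split2 _ _ _ (esym Ez).
  by apply: (Il x y m'); rewrite El Em.
have [_ h1] := Pl _ _ El; have [h2 _] := Pr _ _ Er.
by rewrite sumn_cat size_cat /= /w; lia.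
Qed.

(** The two wins of a node may come in either order, but each only while the subtree on its side is
    still a leaf, so a node wins at most once on each side. *)
Inductive linked v : bintree (tree R) -> tree R -> Prop :=
| Linked_none a : linked v (Bin Leaf a Leaf) a
| Linked_left a (r : bintree _) u (l : bintree _) b :
    linked v (Bin Leaf a r) u -> linked v l b -> linked v (Bin l a r) (win_left u b)
| Linked_right a (l : bintree _) u (r : bintree _) b :
    linked v (Bin l a Leaf) u -> linked v r b -> linked v (Bin l a r) (win_right v u b).

Lemma key_win_left u b : key (win_left u b) = key u.
Proof. by case: u. Qed.

Lemma key_win_right v u b : key (win_right v u b) = key u.
Proof. by case: u. Qed.

Lemma linked_bin v B u : linked v B u -> is_bin B.
Proof. by case. Qed.

Definition win_pot tmp (s : seq (tree R * nat)) : R :=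
  \sum_(p <- s) (pot tmp [:: p.1] + p.2%:R * lgS (twt tmp p.1)).

Definition win_deg tmp (s : seq (tree R * nat)) : nat :=
  \sum_(p <- s) (deg tmp [:: p.1] + tmp (name p.1) * p.2).

(** The root is kept apart from the rest so that both of its wins are priced together, against its
    original children. Priced one after the other, the second win would involve the weight of the
    first loser. *)
Definition linked_shape (B : bintree (tree R)) u : Prop :=
  if B is Bin l a r then
    exists pre post, [/\ name u = name a /\ key u = key a,
      children u = pre ++ children a ++ post,
      (size pre + size post = is_bin l + is_bin r)%N, (size post <= is_bin r)%N &
      forall tmp, [/\ pot tmp (pre ++ post) <= win_pot tmp (inorder l ++ inorder r),
        deg tmp (pre ++ post) = win_deg tmp (inorder l ++ inorder r) &
        perm_eq (names (pre ++ post)) (names (unzip1 (inorder l ++ inorder r)))]]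
  else False.

Lemma linked_shape_total (B : bintree (tree R)) u : linked_shape B u ->
  forall tmp, [/\ pot tmp [:: u] <= win_pot tmp (inorder B),
     deg tmp [:: u] = win_deg tmp (inorder B) &
     perm_eq (names [:: u]) (names (unzip1 (inorder B)))].
Proof.
case: B => //= l a r [pre [post [[Nu Ku] Cu Spp Sp H]]] tmp.
have [Hp Hd Hn] := H tmp; split.
- rewrite pot_cons pot_nil addr0 Cu !pot_cat.
  rewrite /win_pot big_cat big_cons /= -/(win_pot _ _) -/(win_pot _ _).
  rewrite pot_cat /win_pot big_cat /= -/(win_pot _ _) -/(win_pot _ _) in Hp.
  rewrite pot_cons pot_nil addr0.
  have W : level 2 tmp u <= level 2 tmp a + (is_bin l + is_bin r)%:R * lgS (twt tmp a).
    rewrite /level Cu !map_cat.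
    have wl : (is_bin l <= 1)%N by case: (is_bin l).
    have wr : (is_bin r <= 1)%N by case: (is_bin r).
    apply: le_trans (spread_win _ _ _) _; rewrite ?size_map; try lia.
    rewrite Spp sumn_twt lerD2l ler_wpM2l // lgS_le // twtE leq_addl //.
  lra.
- rewrite deg_cons deg_nil addn0 Cu !deg_cat Nu !size_cat.
  rewrite /win_deg big_cat big_cons /= -/(win_deg _ _) -/(win_deg _ _).
  rewrite deg_cat /win_deg big_cat /= -/(win_deg _ _) -/(win_deg _ _) in Hd.
  rewrite deg_cons deg_nil addn0 -Spp; nia.
- rewrite /unzip1 !map_cat /= !names_cat !names_cons !cats0 Nu Cu !names_cat /= in Hn *.
  rewrite -!/(unzip1 _) in Hn *.
  apply/permP => q; move/permP: Hn => /(_ q); rewrite /= !count_cat /= ?count_cat.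
  lia.
Qed.

Lemma linked_shapeP v B u : linked v B u -> linked_shape B u.
Proof.
elim=> {B u} [a|a r u l b _ + lb /linked_shape_total Hb|a l u r b _ + lb /linked_shape_total Hb].
- exists [::], [::]; rewrite cats0; split=> // tmp.
  by rewrite /win_pot /win_deg pot_nil deg_nil !big_nil.
- move=> [pre [post [[Nu Ku] Cu Spp Sp H]]].
  have Cw : children (win_left u b) = b :: children u by case: (u).
  exists (b :: pre), post; rewrite Cw Cu key_win_left (linked_bin lb) /=; split=> //.
  + by split=> //; rewrite -Nu; case: (u).
  + by rewrite /= in Spp; lia.
  move=> tmp; have [Hp Hd Hn] := H tmp; have [Hpb Hdb Hnb] := Hb tmp.
  rewrite /= in Hp Hd Hn; split.
  + by rewrite -cat1s pot_cat /win_pot big_cat lerD.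
  + by rewrite -cat1s deg_cat /win_deg big_cat /= Hdb Hd.
  + by move: (perm_cat Hnb Hn); rewrite -!names_cat /unzip1 map_cat.
- move=> [pre [post [[Nu Ku] Cu Spp Sp H]]].
  (* The right subtree is still a leaf, so no child has been appended yet. *)
  have post0 : post = [::] by apply: size0nil; rewrite /= in Sp; lia.
  rewrite post0 /= ?cats0 in Cu Spp H.
  (* Slim and smooth heaps differ only here: the loser of a right link joins the front children or
     becomes the single appended one. *)
  have [pre' [post' [Cw Spp' Sp' Pp]]] : exists pre' post', [/\
      children (win_right v u b) = pre' ++ children a ++ post',
      (size pre' + size post' = (size pre).+1)%N, (size post' <= 1)%N &
      perm_eq (pre' ++ post') (b :: pre)].
    case: (v).
    + exists (b :: pre), [::]; rewrite !cats0 addn0; split=> //.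
      by move: Cu; case: (u) => ? ? ? /= ->.
    + exists pre, [:: b]; rewrite perm_catC addn1; split=> //.
      by move: Cu; case: (u) => ? ? ? /= ->; rewrite -cats1 -catA.
  have P1 : perm_eq (pre' ++ post') ([:: b] ++ pre) by [].
  exists pre', post'; rewrite Cw key_win_right (linked_bin lb); split=> //.
  + by split=> //; rewrite -Nu; case: (u).
  + by rewrite /= in Spp *; lia.
  move=> tmp; have [Hp Hd Hn] := H tmp; have [Hpb Hdb Hnb] := Hb tmp.
  rewrite ?cats0 /= in Hp Hd Hn.
  have PA : perm_eq (all_subtrees (pre' ++ post')) (all_subtrees ([:: b] ++ pre)).
    exact/perm_flatten/perm_map.
  split.
  + rewrite /pot (perm_big _ PA) /= -/(pot tmp (b :: pre)) -cat1s pot_cat /win_pot big_cat.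
    by rewrite addrC lerD.
  + rewrite /deg (perm_big _ PA) /= -/(deg tmp (b :: pre)) -cat1s deg_cat /win_deg big_cat /=.
    by rewrite Hdb Hd addnC.
  + apply: (perm_trans (perm_map name PA)).
    rewrite -/(names ([:: b] ++ pre)) perm_sym /unzip1 map_cat names_cat perm_catC -names_cat.
    by rewrite perm_sym; move: (perm_cat Hnb Hn); rewrite -!names_cat.
Qed.

End Linking.

(** * Leftmost locally maximum linking produces a Cartesian tree *)

Section LocallyMaximumLinking.
Context {R : realType}.
Implicit Types (t u : tree R) (l : seq (tree R)) (v : variant).

Lemma precE l i j : (i < j)%N ->
  prec l i j = (key (nth_tree l i) < key (nth_tree l j)) /\
  prec l j i = (key (nth_tree l j) <= key (nth_tree l i)).
Proof.
move=> ij; rewrite /prec ij [(j < i)%N]ltnNge (ltnW ij) andbF orbF andbT.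
by rewrite le_eqVlt orbC.
Qed.

(** The first position not followed by a larger node works: the keys ascend up to it. *)
Lemma has_locally_max l : (0 < size l)%N -> has (locally_max l) (iota 0 (size l)).
Proof.
move=> l0.
pose p i := (i.+1 < size l)%N ==> prec l i.+1 i.
have hp : has p (iota 0 (size l)).
  apply/hasP; exists (size l).-1; first by rewrite mem_iota; lia.
  by rewrite /p prednK // ltnn.
have h1 := hp; rewrite has_find size_iota in h1.
have h2 := nth_find 0%N hp.
have h3 i (hi : (i < find p (iota 0 (size l)))%N) := before_find 0%N hi.
set i := find _ _ in h1 h2 h3; rewrite nth_iota // add0n in h2.
apply/hasP; exists i; first by rewrite mem_iota.
apply/andP; split=> //; apply/implyP => i0.
have := h3 i.-1; rewrite nth_iota; last lia.
rewrite add0n prednK // leqnn => /(_ isT) /negbT; rewrite negb_imply prednK // => /andP [_].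
by have [-> ->] := @precE l i.-1 i ltac:(lia); rewrite -ltNge.
Qed.

(** The loser is the local maximum, and the winner is the larger of its neighbours. The side
    conditions compare the winner with the other neighbour of the loser, which the link makes a
    neighbour of the winner; ties are decided by position, so only one of them is strict. *)
Lemma llm_stepP v l : (1 < size l)%N ->
  exists l1 a b l2, l = l1 ++ [:: a, b & l2] /\
   ([/\ key b <= key a, (l1 != [::] -> key (last a l1) < key b) &
        llm_step v l = l1 ++ win_left b a :: l2] \/
    [/\ key a < key b, (l2 != [::] -> key (head a l2) <= key a) &
        llm_step v l = l1 ++ win_right v a b :: l2]).
Proof.
move=> l1.
have hm := @has_locally_max l ltac:(lia).
have hi := hm; rewrite has_find size_iota in hi.
have := nth_find 0%N hm.
rewrite /llm_step; set i := find _ _ in hi *; rewrite nth_iota // add0n => /andP [].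
have dec p : (p.+1 < size l)%N ->
    l = take p l ++ [:: nth_tree l p, nth_tree l p.+1 & drop p.+2 l].
  move=> pl; rewrite /nth_tree -[in LHS](cat_take_drop p l) -drop_nth // -drop_nth //.
  exact: ltnW.
have precS p : prec l p p.+1 = (key (nth_tree l p) < key (nth_tree l p.+1)).
  by have [-> _] := @precE l p p.+1 (ltnSn p).
case: ifP => [/andP [iS cmp]|cmp] /implyP hl /implyP hr.
  have le : key (nth_tree l i.+1) <= key (nth_tree l i).
    by have := hr iS; have [_ ->] := @precE l i i.+1 (ltnSn i).
  exists (take i l), (nth_tree l i), (nth_tree l i.+1), (drop i.+2 l).
  split; first exact: dec.
  left; split=> //; last by rewrite /link precS ltNge le.
  case: (posnP i) cmp => [->|i0]; first by rewrite take0.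
  move=> /= + _.
  have -> : last (nth_tree l i) (take i l) = nth_tree l i.-1.
    rewrite -nth_last size_takel 1?ltnW // nth_take; last lia.
    by apply: set_nth_default; lia.
  by have [-> _] := @precE l i.-1 i.+1 ltac:(lia).
have i0 : (0 < i)%N.
  rewrite lt0n; apply/negP => /eqP i0; move: cmp; rewrite i0 eqxx /= andbT.
  by rewrite i0 in hi; lia.
have ltk : key (nth_tree l i.-1) < key (nth_tree l i).
  by have := hl i0; have [-> _] := @precE l i.-1 i ltac:(lia).
exists (take i.-1 l), (nth_tree l i.-1), (nth_tree l i), (drop i.+1 l).
split; first by have := dec i.-1; rewrite prednK //; apply.
right; split=> //; last by rewrite /link prednK // -[X in prec l _ X](prednK i0) precS prednK //
  ltk.
rewrite -size_eq0 size_drop => h.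
have iS : (i.+1 < size l)%N by move: h; rewrite subn_eq0 -ltnNge.
move: cmp; rewrite iS gt_eqF //=.
have [-> _] := @precE l i.-1 i.+1 ltac:(lia).
by rewrite (drop_nth (Node 0 0 [::]) iS) /= => /negbT; rewrite -leNgt.
Qed.

Lemma size_llm_step v l : (1 < size l)%N -> size (llm_step v l) = (size l).-1.
Proof.
move=> /(llm_stepP v) [l1 [a [b [l2 [-> [[_ _ ->]|[_ _ ->]]]]]]]; rewrite !size_cat /=; lia.
Qed.

(* In the current list of roots, the right neighbour of a winner of a right link
   and the left neighbour of a winner of a left link are smaller than it, so that
   it does not win another link on the same side. *)
Definition adjacent_ok (p q : bintree (tree R) * tree R) : bool :=
  (has_left q.1 ==> (key p.2 < key q.2)) && (has_right p.1 ==> (key q.2 <= key p.2)).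

Definition forest_of (s : seq (bintree (tree R) * tree R)) : seq (tree R) :=
  flatten (map (fun p => unzip1 (inorder p.1)) s).

Definition linking_state v l0 l : Prop :=
  exists s, [/\ unzip2 s = l, sorted adjacent_ok s, forest_of s = l0 &
                List.Forall (fun p => linked v p.1 p.2) s].

Lemma linking_state_init v l : linking_state v l l.
Proof.
exists [seq (Bin Leaf t Leaf, t) | t <- l]; split.
- by rewrite /unzip2 -map_comp map_id.
- by case: l => //= t l; elim: l t => //= u l IH t; rewrite IH.
- by rewrite /forest_of -map_comp; elim: l => //= t l ->.
- by elim: l => [|t l IH]; constructor=> //; constructor.
Qed.

(** A winner that had already won on the same side would, by [adjacent_ok], have a smaller neighbour
    there; but that neighbour is the present loser. So the subtree on that side is a leaf, and the
    side conditions of [llm_stepP] restore [adjacent_ok] for the new neighbours. *)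
Lemma linking_state_step v l0 l :
  (1 < size l)%N -> linking_state v l0 l -> linking_state v l0 (llm_step v l).
Proof.
move=> l1 [s [sl so fo li]].
have [l1' [a [b [l2 [El E]]]]] := llm_stepP v l1.
rewrite El in sl.
have [s1 [A [B [s2 [Es Es1 Es2]]]]] : exists s1 A B s2,
    [/\ s = s1 ++ [:: (A, a), (B, b) & s2], unzip2 s1 = l1' & unzip2 s2 = l2].
  elim: l1' s sl {El E so fo li} => [|c l1' IH] [|[C c'] s] //=.
    by case: s => [|[B b'] s] // [-> -> <-]; exists [::], C, B, s.
  by move=> [-> /IH [s1 [A [B [s2 [-> <- <-]]]]]]; exists ((C, c) :: s1), A, B, s2.
move: so fo li; rewrite Es => so fo /List.Forall_app [li1 li2].
have [la lb li3] : [/\ linked v A a, linked v B b & List.Forall (fun p => linked v p.1 p.2) s2].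
  by inversion li2 as [|? ? ? li3]; inversion li3.
have [so1 so2 so3 so4] : [/\ sorted adjacent_ok s1,
     (~~ nilp s1 -> adjacent_ok (last (A, a) s1) (A, a)),
     adjacent_ok (A, a) (B, b) & path adjacent_ok (B, b) s2].
  move: so; case: (s1) => [|c s1'] /=; first by case/andP.
  by rewrite cat_path /= => /and4P [].
have Ba : linked v A a -> exists (l : bintree _) x r, A = Bin l x r by case; eauto.
have Bb : linked v B b -> exists (l : bintree _) x r, B = Bin l x r by case; eauto.
have [la1 [xa [ra EA]]] := Ba la; have [lb1 [xb [rb EB]]] := Bb lb.
have mk c C : linked v C c ->
    (~~ nilp s1 -> adjacent_ok (last (A, a) s1) (C, c)) ->
    path adjacent_ok (C, c) s2 ->
    unzip1 (inorder C) = unzip1 (inorder A) ++ unzip1 (inorder B) ->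
    linking_state v l0 (l1' ++ c :: l2).
  move=> lc ok1 ok2 Ei; exists (s1 ++ (C, c) :: s2); split.
  - by rewrite /unzip2 map_cat /= -Es1 -Es2.
  - move: ok1 so1; case: (s1) => [|d s1'] //= ok1 so1.
    by rewrite cat_path /= so1 ok2 (ok1 isT).
  - by rewrite -fo /forest_of !map_cat !flatten_cat /= Ei -catA.
  - by apply/List.Forall_app; split=> //; constructor.
have last2 (C : bintree _) c : ~~ nilp s1 -> last c l1' = (last (C, c) s1).2.
  by rewrite -Es1 => _; elim: (s1) C c => //= -[D d] s3 IH C c; apply: IH.
have s1l : (l1' != [::]) = (~~ nilp s1) by rewrite -Es1; case: (s1).
have s2l : (l2 != [::]) = (~~ nilp s2) by rewrite -Es2; case: (s2).
case: E => [[kab kl ->]|[kab kr ->]].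
- have lb1E : lb1 = Leaf.
    move: so3; rewrite /adjacent_ok EB /=; case: (lb1) => //= ? ? ?.
    by rewrite ltNge kab.
  apply: (mk _ (Bin A xb rb)).
  + by constructor=> //; rewrite -lb1E -EB.
  + move=> s1n; move: (so2 s1n) (kl); rewrite s1l => + /(_ s1n).
    rewrite (last2 A a s1n) /adjacent_ok key_win_left /= => /andP [_ h1] h2.
    by rewrite h2 implybT /=; apply/implyP => h3; move/implyP: h1 => /(_ h3); apply: le_trans.
  + case: (s2) so4 => //= d s3 /andP [h1 ->]; rewrite andbT.
    by move: h1; rewrite /adjacent_ok EB /= key_win_left.
  + by rewrite EB lb1E /= /unzip1 map_cat.
- have raE : ra = Leaf.
    move: so3; rewrite /adjacent_ok EA /=; case: (ra) => //= ? ? ?.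
    by rewrite leNgt kab andbF.
  apply: (mk _ (Bin la1 xa B)).
  + by constructor=> //; rewrite -raE -EA.
  + move=> s1n; move: (so2 s1n); rewrite /adjacent_ok EA /= key_win_right //.
  + move: kr; rewrite s2l -Es2; case: (s2) so4 => //= d s3 /andP [h1 ->] /(_ isT) h2.
    rewrite andbT; move: h1; rewrite /adjacent_ok /= key_win_right h2 implybT andbT.
    by move=> /andP [h3 _]; apply/implyP => h4; move/implyP: h3 => /(_ h4); apply: lt_trans.
  + by rewrite EA raE /= /unzip1 !map_cat /= -catA.
Qed.

Lemma llm_linked v l : l != [::] ->
  exists B r, [/\ llm v l = [:: r], linked v B r & unzip1 (inorder B) = l].
Proof.
move=> l0.
have H n : (n < size l)%N -> linking_state v l (iter n (llm_step v) l) /\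
    size (iter n (llm_step v) l) = (size l - n)%N.
  elim: n => [|n IH] nl; first by rewrite subn0; split=> //; exact: linking_state_init.
  have [h1 h2] := IH (ltnW nl); split=> /=; first by apply: linking_state_step => //; lia.
  by rewrite size_llm_step h2; lia.
have sl : (0 < size l)%N by case: (l) l0.
have [] := H (size l).-1 ltac:(lia); rewrite -/(llm v l).
have -> : (size l - (size l).-1 = 1)%N by lia.
move=> [s [<- _ fo li]] sz; case: s fo li sz => [|[B r] [|//]] //= fo li _.
exists B, r; split=> //; first by inversion li.
by move: fo; rewrite /forest_of /= cats0.
Qed.

End LocallyMaximumLinking.

(** * Growth of the potential under linking *)

Section PotentialOfLinking.
Context {R : realType}.
Implicit Types (t u : tree R) (l : seq (tree R)) (tmp : pred nat) (v : variant).

Definition npos tmp l : nat := count (fun t => 0 < twt tmp t)%N l.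

Lemma npos_cat tmp l1 l2 : npos tmp (l1 ++ l2) = (npos tmp l1 + npos tmp l2)%N.
Proof. exact: count_cat. Qed.

Lemma npos_le_wt tmp l : (npos tmp l <= wt tmp l)%N.
Proof. by elim: l => //= t l IH; rewrite wt_cons leq_add //; case: twt. Qed.

Lemma unzip1_cat A B (q : seq (A * B)) x y : unzip1 q = x ++ y ->
  exists qx qy, [/\ q = qx ++ qy, unzip1 qx = x & unzip1 qy = y].
Proof.
move=> E; exists (take (size x) q), (drop (size x) q).
by rewrite cat_take_drop /unzip1 map_take map_drop -/(unzip1 q) E take_size_cat // drop_size_cat.
Qed.

(** The conclusion of [wins_infix], in a form inherited by parts of a list and by its reversal. *)
Definition few_wins A (q : seq (A * nat)) : Prop :=
  forall x y z, q = x ++ y ++ z -> (sumn (unzip2 y) <= (size y).+1)%N.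

Lemma few_wins_cat A (q1 q2 : seq (A * nat)) :
  few_wins (q1 ++ q2) -> few_wins q1 /\ few_wins q2.
Proof.
move=> h; split=> x y z E.
  by apply: (h x y (z ++ q2)); rewrite E -!catA.
by apply: (h (q1 ++ x) y z); rewrite E -!catA.
Qed.

Lemma few_wins_rev A (q : seq (A * nat)) : few_wins q -> few_wins (rev q).
Proof.
move=> h x y z E; have := h (rev z) (rev y) (rev x).
by rewrite size_rev /unzip2 map_rev sumn_rev; apply; rewrite -[q]revK E !rev_cat catA.
Qed.

Lemma few_wins_inorder A (B : bintree A) : few_wins (inorder B).
Proof.
move=> x y z E; have := @wins_infix _ B (unzip2 x) (unzip2 y) (unzip2 z).
by rewrite /wins E /unzip2 !map_cat size_map; apply.
Qed.

(** The unit per winner pays for the growth of [deg]: a temporary node gains at most two children,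
    counted with coefficient 2, whereas charges have coefficient 4. *)
Definition win_cost tmp (q : seq (tree R * nat)) : R :=
  \sum_(p <- q) (p.2%:R * lgS (twt tmp p.1) + ((0 < twt tmp p.1) && (0 < p.2))%N%:R).

Lemma win_cost_cat tmp q1 q2 : win_cost tmp (q1 ++ q2) = win_cost tmp q1 + win_cost tmp q2.
Proof. exact: big_cat. Qed.

(** This is [suf_wins] with excess 1, the excess that [few_wins] allows a prefix. *)
Lemma win_cost_suf tmp q : few_wins q ->
  win_cost tmp q <= suf (map (twt tmp) (unzip1 q)) + 2 * lgS (wt tmp (unzip1 q)).
Proof.
move=> h; pose q' := map (fun p : tree R * nat => (twt tmp p.1, p.2)) q.
have e1 : map (twt tmp) (unzip1 q) = unzip1 q' by rewrite /unzip1 -!map_comp.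
rewrite -sumn_twt e1; have := @suf_wins R 1 q'; rewrite big_map; apply.
move=> i; rewrite size_map => iq.
have -> : unzip2 (take i q') = unzip2 (take i q).
  by rewrite /q' -map_take /unzip2 -map_comp.
have := h [::] (take i q) (drop i q); rewrite cat_take_drop size_takel // => /(_ erefl).
by rewrite add1n.
Qed.

Lemma win_cost_rev tmp q : win_cost tmp (rev q) = win_cost tmp q.
Proof. by apply: perm_big; rewrite perm_rev. Qed.

(** A node of positive weight pays [lgS N] at most twice for its wins and once more for the unit.
    This is the origin of the charge 3 for each such root. *)
Lemma win_cost_roots tmp q N : all (fun p => p.2 <= 2)%N q -> (wt tmp (unzip1 q) <= N)%N ->
  win_cost tmp q <= 3 * ((npos tmp (unzip1 q))%:R * lgS N).
Proof.
elim: q => [|[t w] q IH] /=; first by rewrite /win_cost big_nil mul0r mulr0.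
move=> /andP [w2 aq]; rewrite wt_cons => le.
have {IH} IH := IH aq ltac:(lia).
rewrite /win_cost big_cons -/(win_cost _ _) /=.
have -> (m n : nat) : (m + n)%:R * lgS N = m%:R * lgS N + n%:R * lgS N :> R by rewrite natrD mulrDl.
rewrite mulrDr lerD //.
have [t0|t0] /= := posnP (twt tmp t); first by rewrite t0 lgS0; lra.
have L1 : lgS (twt tmp t) <= lgS N :> R by rewrite lgS_le //; lia.
have L0 : 1 <= lgS (twt tmp t) :> R by exact: lgS_ge1.
have wR : w%:R <= 2 :> R by rewrite (ler_nat R w 2).
have w0 : 0 <= w%:R :> R by [].
have i1 : (0 < w)%N%:R <= 1 :> R by case: (0 < w)%N.
have : w%:R * lgS (twt tmp t) <= 2 * lgS N :> R by apply: ler_pM => //; lra.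
lra.
Qed.

Lemma inorder_wins_le2 A (B : bintree A) : all (fun p => p.2 <= 2)%N (inorder B).
Proof.
elim: B => //= l IHl a r IHr; rewrite all_cat IHl /= IHr andbT.
by case: (is_bin l); case: (is_bin r).
Qed.

(* The inner prefix and suffix sums of the weights of the children [cs] decrease
   away from their common end, and an interval of the list contains at most one
   more node with two wins than without any. *)
Lemma pot_llm tmp v l1 cs l2 N : l1 ++ cs ++ l2 != [::] ->
  (wt tmp (l1 ++ cs ++ l2) <= N)%N ->
  exists r, [/\ llm v (l1 ++ cs ++ l2) = [:: r],
    perm_eq (names [:: r]) (names (l1 ++ cs ++ l2)) &
    4 * pot tmp [:: r] + 2 * (deg tmp [:: r])%:R <=
      4 * (pot tmp (l1 ++ cs ++ l2) + spread (drop 2 (map (twt tmp) cs)) + 7 * lgS N +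
           3 * ((npos tmp l1 + npos tmp l2)%:R * lgS N)) +
      2 * (deg tmp (l1 ++ cs ++ l2))%:R].
Proof.
set l := l1 ++ cs ++ l2 => l0 lN.
have [B [r [-> lr EB]]] := llm_linked v l0.
have [Hp Hd Hn] := linked_shape_total (linked_shapeP lr) tmp.
exists r; split=> //; first by rewrite -EB.
have W2 := inorder_wins_le2 B; have FW : few_wins (inorder B) := @few_wins_inorder _ B.
set q := inorder B in Hp Hd W2 FW EB.
have Ep : win_pot tmp q = pot tmp l + \sum_(p <- q) (p.2%:R * lgS (twt tmp p.1)).
  rewrite /win_pot big_split /= -EB; congr (_ + _).
  by elim: (q) => [|p q' IH]; rewrite ?big_nil ?pot_nil // big_cons IH /= -pot_cat.
have Ed : win_deg tmp q = (deg tmp l + \sum_(p <- q) tmp (name p.1) * p.2)%N.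
  rewrite /win_deg big_split /= -EB; congr (_ + _)%N.
  by elim: (q) => [|p q' IH]; rewrite ?big_nil ?deg_nil // big_cons IH /= -deg_cat.
have Et : (\sum_(p <- q) tmp (name p.1) * p.2)%N%:R <=
    2 * \sum_(p <- q) ((0 < twt tmp p.1) && (0 < p.2))%N%:R :> R.
  move: W2; elim: (q) => [|[t w] q' IH] /=; first by rewrite !big_nil mulr0.
  move=> /andP [w2 /IH {}IH]; rewrite !big_cons /= natrD mulrDr lerD //.
  rewrite twtE; case: (tmp _); rewrite ?mul0n ?mulr_ge0 // mul1n add1n /=.
  by case: w w2 => [|w] //= w2; rewrite ?mulr0 // mulr1 (ler_nat R _ 2).
have Ec : win_cost tmp q = \sum_(p <- q) (p.2%:R * lgS (twt tmp p.1)) +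
    \sum_(p <- q) ((0 < twt tmp p.1) && (0 < p.2))%N%:R by exact: big_split.
(* The 7 consists of 3 for the exemptions in [suf_le_spread] and of 2 for each half of [cs] by
   [win_cost_suf]; the right half is read from its end. The nodes of [l1] and [l2] are paid as
   roots. *)
suff C : win_cost tmp q <= spread (drop 2 (map (twt tmp) cs)) + 7 * lgS N +
           3 * ((npos tmp l1 + npos tmp l2)%:R * lgS N).
  rewrite Hd Ed natrD; rewrite Ep in Hp; lra.
have [q1 [qc2 [Eq E1 Ec2]]] := unzip1_cat EB.
have [qc [q2 [Eqc2 Ecs E2]]] := unzip1_cat Ec2.
have [a [b [Eab le]]] := @suf_le_spread R (map (twt tmp) cs).
have [qa [qb [Eqc Ea Eb]]] : exists qa qb, [/\ qc = qa ++ qb,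
    map (twt tmp) (unzip1 qa) = a & map (twt tmp) (unzip1 qb) = b].
  exists (take (size a) qc), (drop (size a) qc); rewrite cat_take_drop.
  rewrite /unzip1 [X in map _ X]map_take [X in map _ X = b]map_drop map_take map_drop.
  by rewrite -/(unzip1 qc) Ecs Eab take_size_cat // drop_size_cat.
rewrite Eq Eqc2 Eqc -catA !win_cost_cat.
move: W2 FW; rewrite Eq Eqc2 Eqc -catA !all_cat => /and4P [W1 _ _ W2].
move=> /few_wins_cat [_ /few_wins_cat [Fa /few_wins_cat [/few_wins_rev Fb _]]].
have [w1 wa wb w2 wc] : [/\ wt tmp l1 <= N, wt tmp (unzip1 qa) <= N, wt tmp (unzip1 qb) <= N,
    wt tmp l2 <= N & wt tmp cs <= N]%N.
  have : wt tmp cs = (wt tmp (unzip1 qa) + wt tmp (unzip1 qb))%N.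
    by rewrite -wt_cat -Ecs Eqc /unzip1 map_cat.
  by move: lN; rewrite /l !wt_cat; clear => h1 h2; split; lia.
have H1 := @win_cost_roots tmp q1 N W1; rewrite E1 in H1; have {H1} H1 := H1 w1.
have H2 := @win_cost_roots tmp q2 N W2; rewrite E2 in H2; have {H2} H2 := H2 w2.
have Ha := win_cost_suf tmp Fa.
have Hb := win_cost_suf tmp Fb; rewrite win_cost_rev in Hb.
have La : lgS (wt tmp (unzip1 qa)) <= lgS N :> R by exact: lgS_le.
have Lb : lgS (wt tmp (unzip1 (rev qb))) <= lgS N :> R.
  by rewrite lgS_le // -sumn_twt /unzip1 !map_rev sumn_rev sumn_twt.
have Lc : lgS (sumn (map (twt tmp) cs)) <= lgS N :> R by rewrite lgS_le // sumn_twt.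
move: Ha Hb; rewrite Ea /unzip1 !map_rev -/(unzip1 _) Eb => Ha Hb.
rewrite /unzip1 !map_rev in Lb.
rewrite natrD mulrDl.
move: H1 H2 Ha Hb La Lb Lc le; clear; lra.
Qed.

Definition rpot d tmp l : R := \sum_(t <- l) (level d tmp t + pot tmp (children t)).

Lemma rpot_cat d tmp l1 l2 : rpot d tmp (l1 ++ l2) = rpot d tmp l1 + rpot d tmp l2.
Proof. exact: big_cat. Qed.

Lemma rpot_cons d tmp t l :
  rpot d tmp (t :: l) = level d tmp t + pot tmp (children t) + rpot d tmp l.
Proof. exact: big_cons. Qed.

Lemma rpot_nil d tmp : rpot d tmp [::] = 0.
Proof. exact: big_nil. Qed.

Lemma rpot2 tmp l : rpot 2 tmp l = pot tmp l.
Proof. by elim: l => [|t l IH]; rewrite ?rpot_nil ?pot_nil // rpot_cons IH pot_cons. Qed.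

Lemma rpot_ge0 d tmp l : 0 <= rpot d tmp l.
Proof. by apply: sumr_ge0 => t _; rewrite addr_ge0 ?level_ge0 ?pot_ge0. Qed.

Lemma rpot_succ d tmp l : rpot d.+1 tmp l <= rpot d tmp l.
Proof.
apply: ler_sum => t _; rewrite lerD2r; apply: spread_shrunk.
by rewrite -add1n -drop_drop drop1; apply/shrunk_behead_l/shrunk_refl.
Qed.

(** The first node has no left neighbour and counts as larger than its right one even when the keys
    are equal, so it is the leftmost local maximum and loses a left link. *)
Lemma llm_cons2 v (a b : tree R) l : key b <= key a ->
  llm v [:: a, b & l] = llm v (win_left b a :: l).
Proof.
move=> ba; rewrite /llm /= -iterS iterSr; congr iter.
rewrite /llm_step; set m := [:: a, b & l].
have [p01 p10] := @precE R m 0 1 isT.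
have -> : find (locally_max m) (iota 0 (size m)) = 0%N.
  by rewrite /= /locally_max /= p10 /nth_tree /= ba.
by rewrite /= /link p01 /nth_tree /= ltNge ba /= drop0.
Qed.

(* Linking roots in order of non-increasing keys makes each of them the new
   leftmost child of the next one. *)
Lemma llm_sorted v (a : tree R) s : sorted (fun t u => key u <= key t) (a :: s) ->
  exists r, [/\ llm v (a :: s) = [:: r], perm_eq (names [:: r]) (names (a :: s)) &
    forall tmp, pot tmp [:: r] <= pot tmp [:: a] + rpot 1 tmp s /\
      (deg tmp [:: r] <= deg tmp (a :: s) + size s)%N].
Proof.
elim: s a => [|b s IH] a.
  by move=> _; exists a; split=> // tmp; rewrite rpot_nil addr0 addn0.
rewrite /= => /andP [ba hs]; rewrite llm_cons2 //.
have [|r [-> Hn H]] := IH (win_left b a).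
  by case: s hs {IH} => //= c s; rewrite key_win_left.
have Cw : children (win_left b a) = a :: children b by case: (b).
have Nw : name (win_left b a) = name b by case: (b).
exists r; split=> //.
  apply: (perm_trans Hn); rewrite names_cons Nw Cw.
  apply/permP => p; rewrite !names_cons /= !count_cat /= ?names_cons /= ?count_cat /=; lia.
move=> tmp; have [Hp Hd] := H tmp; split.
  rewrite [pot _ [:: win_left _ _] ]pot_cons pot_nil addr0 Cw in Hp; rewrite rpot_cons.
  (* With the new child in front, dropping two children is the same as dropping one of the old ones,
     so the charge of [b] does not change. *)
  have E : level 2 tmp (win_left b a) = level 1 tmp b by rewrite /level Cw.
  rewrite E -(cat1s a (children b)) pot_cat in Hp; lra.
rewrite !deg_cons Nw Cw deg_cons /= in Hd *.
by have : (tmp (name b) <= 1)%N; [case: (tmp _)|nia].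
Qed.

End PotentialOfLinking.

(** * Replacing a subtree inside a forest *)

Section Splicing.
Context {R : realType}.
Implicit Types (t u c : tree R) (l : seq (tree R)) (tmp : pred nat)
  (f : tree R -> seq (tree R)).

Lemma splice_cat x f l1 l2 : splice x f (l1 ++ l2) = splice x f l1 ++ splice x f l2.
Proof. by rewrite /splice map_cat flatten_cat. Qed.

Lemma splice_cons x f t l : splice x f (t :: l) = tsplice x f t ++ splice x f l.
Proof. by []. Qed.

Lemma tsplice_notin x f t : x \notin names [:: t] -> tsplice x f t = [:: t].
Proof.
elim/(@tree_ind_in R): t => y k cs IH; rewrite names_cons /= cats0 in_cons negb_or.
move=> /andP [xy xcs]; rewrite eq_sym (negbTE xy); congr [:: Node y k _].
elim: cs IH xcs => //= c cs IHcs IH; rewrite -cat1s names_cat mem_cat negb_or => /andP [xc xcs].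
by rewrite IH ?mem_head // IHcs // => d dcs; apply: IH; rewrite in_cons dcs orbT.
Qed.

Lemma splice_notin x f l : x \notin names l -> splice x f l = l.
Proof.
elim: l => //= t l IH; rewrite -cat1s names_cat mem_cat negb_or => /andP [xt /IH xl].
by rewrite splice_cons xl tsplice_notin.
Qed.

Lemma subtree_name t l : t \in all_subtrees l -> name t \in names l.
Proof. exact: map_f. Qed.

Lemma subtree_split t l : t \in all_subtrees l ->
  exists l1 c l2, l = l1 ++ c :: l2 /\ t \in all_subtrees [:: c].
Proof.
elim: l => //= c l IH; rewrite -cat1s all_subtrees_cat mem_cat => /orP [h|/IH [l1 [d [l2 [-> h]]]]].
  by exists [::], c, l.
by exists (c :: l1), d, l2.
Qed.

Lemma splice_split x f l t : uniq (names l) -> t \in all_subtrees l -> name t = x ->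
  exists l1 c l2, [/\ l = l1 ++ c :: l2, t \in all_subtrees [:: c], uniq (names [:: c]),
    splice x f l = l1 ++ tsplice x f c ++ l2 & name c = x -> t = c].
Proof.
move=> ul /subtree_split [l1 [c [l2 [El tc]]]] tx; exists l1, c, l2.
move: ul; rewrite El -cat1s !names_cat cat_uniq has_cat negb_or cat_uniq.
move=> /and3P [u1 /andP [dc _] /and3P [uc dl u2]].
have xc : x \in names [:: c] by rewrite -tx subtree_name.
split=> //.
  rewrite splice_cat splice_cons !splice_notin //.
    by apply/negP => h; move/hasPn: dl => /(_ _ h) /=; rewrite xc.
  by apply/negP => h; move/hasPn: dc => /(_ _ xc) /=; rewrite h.
move=> cx; move: tc uc; rewrite all_subtrees_cons cats0 in_cons => /orP [/eqP //|].
by move=> /subtree_name; rewrite names_cons cats0 /= tx -cx => ->.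
Qed.

(** The account of an exchange, [t] against [r], written without subtraction; it serves for cuts as
    well as for deletions. *)
Definition spliced tmp l l' t r : Prop :=
  [/\ pot tmp l' + pot tmp [:: t] <= pot tmp l + pot tmp r,
      (deg tmp l' + deg tmp [:: t] <= deg tmp l + deg tmp r)%N,
      perm_eq (names l' ++ names [:: t]) (names l ++ names r),
      shrunk (map (twt tmp) l') (map (twt tmp) l) &
      (size l' <= size l)%N].

Lemma spliced_mid tmp l1 c l2 l' t r : spliced tmp [:: c] l' t r ->
  spliced tmp (l1 ++ c :: l2) (l1 ++ l' ++ l2) t r.
Proof.
move=> [h1 h2 h3 h4 h5]; rewrite -cat1s; split.
- by rewrite !pot_cat; lra.
- by rewrite !deg_cat; lia.
- apply/permP => p; move/permP: h3 => /(_ p).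
  by rewrite !names_cat !count_cat; lia.
- rewrite !map_cat; apply: shrunk_cat; first exact: shrunk_refl.
  by apply: shrunk_cat => //; exact: shrunk_refl.
- by rewrite !size_cat /=; rewrite /= in h5; lia.
Qed.

(** The replacement is at most one tree and is no heavier, so the child weights of every ancestor
    only shrink and [spread_shrunk] applies. The second half isolates the root, whose level has to
    be controlled for every [d]: roots of the buffer use [d = 1]. *)
Lemma tspliceP tmp x f t u : uniq (names [:: u]) -> t \in all_subtrees [:: u] ->
  name t = x -> (name u = x -> t = u) ->
  (size (f t) <= 1)%N -> (wt tmp (f t) <= twt tmp t)%N ->
  spliced tmp [:: u] (tsplice x f u) t (f t) /\
  (name u <> x -> exists u', [/\ tsplice x f u = [:: u'], name u' = name u,
     forall d, level d tmp u' <= level d tmp u &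
     pot tmp (children u') + pot tmp [:: t] <= pot tmp (children u) + pot tmp (f t)]).
Proof.
move=> uu tu tx eqt sf wf; elim/(@tree_ind_in R): u uu tu eqt => y k cs IH uu tu eqt.
have [yx|yx] := eqVneq y x.
  have -> : tsplice x f (Node y k cs) = f t by rewrite (eqt yx) /= yx eqxx.
  split=> //; rewrite -(eqt yx); split.
  - by rewrite addrC.
  - by rewrite addnC.
  - by rewrite perm_catC.
  - case: (f t) sf wf => [|r [|//]] _ /=; first by left.
    by rewrite /twt => w; right; exists (wt tmp [:: r]), [::].
  - by [].
have tcs : t \in all_subtrees cs.
  move: tu; rewrite all_subtrees_cons cats0 in_cons => /orP [/eqP E|//].
  by move: yx; rewrite -tx E eqxx.
move: uu; rewrite names_cons cats0 /= => /andP [_ ucs].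
have [l1 [c [l2 [El tc uc Es ct]]]] := splice_split f ucs tcs tx.
have [|S _] := IH c _ uc tc ct; first by rewrite El mem_cat mem_head orbT.
have {S} := spliced_mid l1 l2 S; rewrite -El -Es => -[h1 h2 h3 h4 h5].
rewrite (negbTE yx) -/(splice x f cs).
have lev d : level d tmp (Node y k (splice x f cs)) <= level d tmp (Node y k cs).
  by rewrite /level /=; apply/spread_shrunk/shrunk_drop.
split; last by move=> _; exists (Node y k (splice x f cs)).
have nm : perm_eq (names [:: Node y k (splice x f cs)] ++ names [:: t])
          (names [:: Node y k cs] ++ names (f t)).
  by rewrite !(@names_cons _ (Node _ _ _)) !cats0 /= perm_cons.
split=> //.
- by rewrite ![pot _ [:: Node _ _ _] ]pot_cons !pot_nil /=; have := lev 2%N; lra.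
- by rewrite ![deg _ [:: Node _ _ _] ]deg_cons !deg_nil /=; nia.
- move/permP: nm => /(_ tmp); rewrite !count_cat -!/(wt tmp _) => nm.
  right; exists (twt tmp (Node y k (splice x f cs))), [::]; split=> //.
  by rewrite /twt in wf *; lia.
Qed.

Lemma spliceP tmp x f t l : uniq (names l) -> t \in all_subtrees l ->
  name t = x -> (size (f t) <= 1)%N -> (wt tmp (f t) <= twt tmp t)%N ->
  spliced tmp l (splice x f l) t (f t) /\
  (x \notin map name l -> forall d,
    rpot d tmp (splice x f l) + pot tmp [:: t] <= rpot d tmp l + pot tmp (f t)).
Proof.
move=> ul tl tx sf wf.
have [l1 [c [l2 [-> tc uc -> ct]]]] := splice_split f ul tl tx.
have [S T] := tspliceP uc tc tx ct sf wf.
split; first exact: spliced_mid.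
rewrite map_cat mem_cat in_cons !negb_or => /and3P [_ xc _] d.
have [|u [-> _ lev h]] := T; first by move=> E; rewrite E eqxx in xc.
by rewrite !rpot_cat !rpot_cons rpot_nil; have := lev d; lra.
Qed.

Lemma splice_root x f l1 t l2 : uniq (names (l1 ++ t :: l2)) -> name t = x ->
  splice x f (l1 ++ t :: l2) = l1 ++ f t ++ l2.
Proof.
rewrite -cat1s !names_cat cat_uniq has_cat negb_or cat_uniq.
move=> /and3P [u1 /andP [dc _] /and3P [uc dl u2]] tx.
have xt : x \in names [:: t] by rewrite names_cons -tx mem_head.
rewrite splice_cat splice_cons !splice_notin //.
- by congr (_ ++ (_ ++ _)); case: t tx {uc dl dc xt} => y k cs /= ->; rewrite eqxx.
- by apply/negP => h; move/hasPn: dl => /(_ _ h) /=; rewrite xt.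
- by apply/negP => h; move/hasPn: dc => /(_ _ xt) /=; rewrite h.
Qed.

Lemma shrunk_npos tmp l' l : shrunk (map (twt tmp) l') (map (twt tmp) l) ->
  (npos tmp l' <= npos tmp l)%N.
Proof.
rewrite /npos -!(count_map (twt tmp) (fun n => 0 < n)%N).
move: (map _ l') (map _ l) => z' z; elim: z z' => [|x z IH] z' /= => [->//|].
by case=> [/IH|[y [z1 [-> yx /IH]]]] /=; lia.
Qed.

End Splicing.

(** * The potential of a heap and the effect of a cut *)

Section HeapPotential.
Context {R : realType}.
Implicit Types (t u : tree R) (l rl b : seq (tree R)) (tmp : pred nat) (H : heap R).

Lemma perm_countP (s s' : seq nat) :
  perm_eq s s' <-> forall p : pred nat, count p s = count p s'.
Proof. by split=> [/permP|] // h; apply/permP. Qed.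

Lemma perm_names l l' : perm_eq l l' -> perm_eq (names l) (names l').
Proof. by move=> ll'; apply/perm_map/perm_flatten/perm_map. Qed.

Lemma perm_rpot d tmp l l' : perm_eq l l' -> rpot d tmp l = rpot d tmp l'.
Proof. by move=> P; apply: (perm_big _ P). Qed.

Lemma perm_deg tmp l l' : perm_eq l l' -> deg tmp l = deg tmp l'.
Proof. by move=> P; apply: perm_big; apply/perm_flatten/perm_map. Qed.

Lemma perm_npos tmp l l' : perm_eq l l' -> npos tmp l = npos tmp l'.
Proof. by move/permP => h; apply: h. Qed.

Definition heap_wt tmp H : nat := count tmp (nodes H).

(* The last term pays for emptying the buffer of the smaller heap in a meld. *)
Definition core tmp H : R :=
  4 * (rpot 2 tmp (roots H) + rpot 1 tmp (buffer H) +
       3 * ((npos tmp (roots H))%:R * lgS (heap_wt tmp H)) -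
       3 * ((heap_wt tmp H)%:R * lgS (heap_wt tmp H))) +
  2 * ((deg tmp (roots H))%:R + (deg tmp (buffer H))%:R +
       (size (roots H))%:R + (size (buffer H))%:R) +
  12 * lgS (heap_size H).

Lemma npos_le_heap_wt tmp H : (npos tmp (roots H) <= heap_wt tmp H)%N.
Proof.
apply: leq_trans (npos_le_wt _ _) _.
by rewrite /heap_wt /nodes names_cat count_cat leq_addr.
Qed.

(** The common factor [k - t] of the logarithm is not positive, so enlarging the heap around given
    roots and temporary nodes only lowers their share of the potential. *)
Lemma root_term_le (k t t' : nat) : (k <= t)%N -> (t <= t')%N ->
  k%:R * lgS t' - t%:R * lgS t' <= k%:R * lgS t - t%:R * lgS t :> R.
Proof.
move=> kt tt'; rewrite -!mulrBl ler_wnM2l ?lgS_le //.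
by rewrite subr_le0 ler_nat.
Qed.

Lemma coreE tmp rl b : core tmp (Heap rl b) =
  4 * (rpot 2 tmp rl + rpot 1 tmp b +
       3 * ((npos tmp rl)%:R * lgS (heap_wt tmp (Heap rl b))) -
       3 * ((heap_wt tmp (Heap rl b))%:R * lgS (heap_wt tmp (Heap rl b)))) +
  2 * ((deg tmp rl)%:R + (deg tmp b)%:R + (size rl)%:R + (size b)%:R) +
  12 * lgS (heap_size (Heap rl b)).
Proof. by []. Qed.

Lemma core_perm tmp rl rl' b : perm_eq rl' rl -> core tmp (Heap rl' b) = core tmp (Heap rl b).
Proof.
move=> P; rewrite /core /heap_wt /heap_size /nodes /=.
have Pn : perm_eq (names (rl' ++ b)) (names (rl ++ b)) by apply: perm_names; rewrite perm_cat2r.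
by rewrite (perm_rpot _ _ P) (perm_npos _ P) (perm_deg _ P) (perm_size P)
  (perm_size Pn) (permP Pn).
Qed.

Lemma core_le tmp H H' (dp dd : R) : (heap_wt tmp H' = heap_wt tmp H) ->
  (heap_size H' <= heap_size H)%N -> (npos tmp (roots H') <= npos tmp (roots H))%N ->
  rpot 2 tmp (roots H') + rpot 1 tmp (buffer H') <=
    rpot 2 tmp (roots H) + rpot 1 tmp (buffer H) + dp ->
  (deg tmp (roots H') + deg tmp (buffer H') + size (roots H') + size (buffer H'))%:R <=
  (deg tmp (roots H) + deg tmp (buffer H) + size (roots H) + size (buffer H))%:R + dd ->
  core tmp H' <= core tmp H + 4 * dp + 2 * dd.
Proof.
move=> ew hs np h1; rewrite !natrD => h2; rewrite /core ew.
have hn : (npos tmp (roots H'))%:R * lgS (heap_wt tmp H) <=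
          (npos tmp (roots H))%:R * lgS (heap_wt tmp H) :> R.
  by rewrite ler_wpM2r ?lgS_ge0 // ler_nat.
have hl := @lgS_le R _ _ hs; lra.
Qed.

Lemma names_key x (k k0 : R) cs l1 l2 :
  names (l1 ++ Node x k cs :: l2) = names (l1 ++ Node x k0 cs :: l2).
Proof. by rewrite !names_cat !names_cons. Qed.

(** The cut node loses its first child, and its level 1 charge in the buffer then equals its former
    level 2 charge. Its ancestors see only lighter or fewer children. The 2 is for the additional
    root in the buffer. *)
Lemma cut_nonroot_core tmp x (k k0 : R) cs rl b :
  let f t := take 1 (children t) in
  uniq (names (rl ++ b)) -> x \notin map name (rl ++ b) ->
  Node x k0 cs \in all_subtrees (rl ++ b) ->
  let H' := Heap (splice x f rl) (Node x k (behead cs) :: splice x f b) in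
  [/\ perm_eq (nodes H') (names (rl ++ b)), core tmp H' <= core tmp (Heap rl b) + 2 &
      (size (buffer H') <= (size b).+1)%N].
Proof.
move=> f uH xr tx H'; rewrite {}/H'.
set t := Node x k0 cs in tx.
have [t' Et'] : exists t' : tree R, t' = Node x k (behead cs) by eexists.
have ft : f t = take 1 cs by [].
have Ecs : cs = f t ++ behead cs by rewrite ft -drop1 cat_take_drop.
have sf : (size (f t) <= 1)%N by rewrite ft size_take; case: ltnP.
have wf : (wt tmp (f t) <= twt tmp t)%N.
  have : wt tmp cs = (wt tmp (f t) + wt tmp (behead cs))%N by rewrite -wt_cat -Ecs.
  by rewrite twtE /=; lia.
have pt : level 1 tmp t' + pot tmp (behead cs) + pot tmp (f t) = pot tmp [:: t].
  have : pot tmp cs = pot tmp (f t) + pot tmp (behead cs) by rewrite -pot_cat -Ecs.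
  rewrite pot_cons pot_nil addr0 /=.
  have -> : level 1 tmp t' = level 2 tmp t by rewrite Et' /level /=; case: (cs) => //= c [|d l].
  lra.
have dt : (deg tmp [:: t'] + deg tmp (f t) <= deg tmp [:: t])%N.
  have : deg tmp cs = (deg tmp (f t) + deg tmp (behead cs))%N by rewrite -deg_cat -Ecs.
  rewrite Et' !deg_cons deg_nil !addn0 /= size_behead.
  by have : (tmp x * (size cs).-1 <= tmp x * size cs)%N; [rewrite leq_mul2l leq_pred orbT|lia].
have ct p : count p (names [:: t]) = (count p (names [:: t']) + count p (names (f t)))%N.
  have : count p (names cs) = (count p (names (f t)) + count p (names (behead cs)))%N.
    by rewrite -count_cat -names_cat -Ecs.
  by rewrite Et' !names_cons /= !cats0; lia.
have ct' : pot tmp (children t') = pot tmp (behead cs) by rewrite Et'.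
rewrite -Et'; suff S : let rl' := splice x f rl in let b' := splice x f b in
    [/\ perm_eq (names (rl' ++ t' :: b')) (names (rl ++ b)),
        rpot 2 tmp rl' + rpot 1 tmp (t' :: b') <= rpot 2 tmp rl + rpot 1 tmp b,
        (deg tmp rl' + deg tmp (t' :: b') <= deg tmp rl + deg tmp b)%N,
        (npos tmp rl' <= npos tmp rl)%N &
        (size rl' <= size rl)%N /\ (size b' <= size b)%N].
  have [S1 S2 S3 S4 [S5 S6]] := S; split=> //; rewrite /= ?ltnS //.
  have -> : (core tmp (Heap rl b) + 2 = core tmp (Heap rl b) + 4 * 0 + 2 * 1) by lra.
  apply: core_le; rewrite /= ?addr0 //.
  + by rewrite /heap_wt (permP S1).
  + by rewrite /heap_size (perm_size S1).
  + rewrite natr1 ler_nat; move: S3 S5 S6; clear => h1 h2 h3.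
    by rewrite addnS ltnS; do 2! apply: leq_add => //.
rewrite /nodes /= names_cat cat_uniq in uH; case/and3P: uH => url dis ub.
have xd : x \in names rl -> x \in names b -> False.
  by move=> h1 h2; move/hasPn: dis => /(_ _ h2) /=; rewrite h1.
rewrite map_cat mem_cat negb_or in xr; case/andP: xr => xrl xb.
move: tx; rewrite -/(all_subtrees _) all_subtrees_cat mem_cat => /orP [tin|tin] rl' b'.
- have bb : b' = b.
    by apply: splice_notin; apply/negP => h; exact: xd (subtree_name tin) h.
  have [[s1 s2 s3 s4 s5] /(_ xrl 2%N) s6] := spliceP url tin erefl sf wf.
  rewrite bb -/rl' in s1 s2 s3 s4 s5 s6 *; split=> //.
  + apply/perm_countP => p; move/perm_countP: s3 => /(_ p).
    rewrite -(cat1s t') !names_cat !count_cat ct; clear; lia.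
  + by rewrite rpot_cons ct'; lra.
  + by rewrite -(cat1s t') deg_cat; move: s2 dt; clear; lia.
  + exact: shrunk_npos s4.
- have rr : rl' = rl.
    by apply: splice_notin; apply/negP => h; exact: xd h (subtree_name tin).
  have [[s1 s2 s3 s4 s5] /(_ xb 1%N) s6] := spliceP ub tin erefl sf wf.
  rewrite rr -/b' in s1 s2 s3 s4 s5 s6 *; split=> //.
  + apply/perm_countP => p; move/perm_countP: s3 => /(_ p).
    rewrite -(cat1s t') !names_cat !count_cat ct; clear; lia.
  + by rewrite rpot_cons ct'; lra.
  + by rewrite -(cat1s t') deg_cat; move: s2 dt; clear; lia.
Qed.

(** [core] depends neither on keys nor on the order of the roots, so only the cut of a node that is
    not a root can change it. *)
Lemma cut_core tmp x k H H' : uniq (nodes H) -> cut x k H H' ->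
  [/\ perm_eq (nodes H') (nodes H), core tmp H' <= core tmp H + 2 &
      (size (buffer H') <= (size (buffer H)).+1)%N].
Proof.
move=> uH C; case: C uH => {H H'}.
- move=> l1 k0 cs l2 b _ _.
  set rl' := (X in core tmp (Heap X b) <= _).
  have P : perm_eq rl' (l1 ++ Node x k cs :: l2).
    rewrite /rl'; case: (l1) => //= r l1'; case: ifP => // _.
    by apply/permP => p; rewrite /= !count_cat /=; lia.
  split=> //=.
  + rewrite /nodes /= [names ((l1 ++ _) ++ b)]names_cat -(names_key x k k0) -names_cat.
    by apply: perm_names; rewrite perm_cat2r.
  + rewrite (core_perm _ _ P).
    have -> : core tmp (Heap (l1 ++ Node x k cs :: l2) b) =
              core tmp (Heap (l1 ++ Node x k0 cs :: l2) b).
      rewrite /core /heap_wt /heap_size /nodes /= -!catA !cat_cons (names_key x k k0).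
      by rewrite !rpot_cat !rpot_cons !npos_cat !deg_cat !deg_cons !size_cat.
    by rewrite lerDl.
- move=> rl b1 k0 cs b2 _ _; split=> //=.
  + by rewrite /nodes /= !catA (names_key x k k0).
  + have -> : core tmp (Heap rl (b1 ++ Node x k cs :: b2)) =
              core tmp (Heap rl (b1 ++ Node x k0 cs :: b2)).
      rewrite /core /heap_wt /heap_size /nodes /= !catA (names_key x k k0).
      by rewrite !rpot_cat !rpot_cons !deg_cat !deg_cons !size_cat.
    by rewrite lerDl.
  + by rewrite !size_cat /=.
by move=> rl b k0 cs _ xr tx uH; exact: cut_nonroot_core uH xr tx.
Qed.

End HeapPotential.

(** * The effect of a deletion on the potential *)

Section Deletions.
Context {R : realType}.
Implicit Types (t u : tree R) (l rl b : seq (tree R)) (tmp : pred nat) (H : heap R)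
  (v : variant) (f : tree R -> seq (tree R)).

(** By [lgS_step], losing one temporary node raises the negative term by at most [lgS t + 2]. *)
Lemma delete_step (k' k t : nat) : (k' <= k)%N -> (0 < t)%N ->
  k'%:R * lgS t.-1 - t.-1%:R * lgS t.-1 <= k%:R * lgS t - t%:R * lgS t + lgS t + 2 :> R.
Proof.
move=> kk; case: t => // t _ /=; have := @lgS_step R t.
have : k'%:R * lgS t <= k%:R * lgS t.+1 :> R.
  by apply: ler_pM; rewrite ?lgS_ge0 ?lgS_le ?ler_nat.
lra.
Qed.

Lemma pot_llm_le tmp v l1 cs l2 N : (wt tmp (l1 ++ cs ++ l2) <= N)%N ->
  let res := llm v (l1 ++ cs ++ l2) in
  [/\ (size res <= 1)%N, perm_eq (names res) (names (l1 ++ cs ++ l2)) &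
    4 * pot tmp res + 2 * (deg tmp res)%:R <=
      4 * (pot tmp (l1 ++ cs ++ l2) + spread (drop 2 (map (twt tmp) cs)) + 7 * lgS N +
           3 * ((npos tmp l1 + npos tmp l2)%:R * lgS N)) +
      2 * (deg tmp (l1 ++ cs ++ l2))%:R].
Proof.
move=> lN; have [l0|l0] := eqVneq (l1 ++ cs ++ l2) [::]; last first.
  by have [r [-> Hn Hp]] := pot_llm v l0 lN; split.
rewrite /= l0; split=> //.
have := @spread_ge0 R (drop 2 (map (twt tmp) cs)); have := @lgS_ge0 R N.
have : 0 <= (npos tmp l1 + npos tmp l2)%:R * lgS N :> R by rewrite mulr_ge0 ?lgS_ge0.
rewrite /= deg_nil pot_nil; lra.
Qed.

Lemma llm_time_le l : llm_time l <= 2 * (size l)%:R :> R.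
Proof. by rewrite /llm_time -natrM ler_nat; lia. Qed.

(** The charge of [x] is exactly the [spread] term of [pot_llm]; its degree and the roots that
    vanish pay for the traversal and the links. The 52 is [4 * 7] from linking plus [12 * 2] from
    the one remaining root and the lost temporary node. *)
Lemma delete_root_core tmp v x (k : R) l1 cs l2 : tmp x ->
  let H := Heap (l1 ++ Node x k cs :: l2) [::] in
  let l := l1 ++ cs ++ l2 in let H' := Heap (llm v l) [::] in
  perm_eq (x :: nodes H') (nodes H) /\
  llm_time l + core tmp H' <= core tmp H + 52 * lgS (heap_wt tmp H) + 30.
Proof.
move=> tx H l H'.
have Nn : perm_eq (nodes H) (x :: names l).
  rewrite /nodes /= cats0 /l; apply/perm_countP => p.
  by rewrite -(cat1s (Node x k cs)) !names_cat names_cons /= cats0 !count_cat /= count_cat; lia.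
set t := heap_wt tmp H.
have Et : t = (wt tmp l).+1 by rewrite /t /heap_wt (permP Nn) /= tx.
have [sr nr hp] := @pot_llm_le tmp v l1 cs l2 t ltac:(rewrite Et; exact: leqnSn).
have Nn' : perm_eq (nodes H') (names l) by rewrite /nodes /= cats0.
have ew : heap_wt tmp H' = t.-1 by rewrite /heap_wt (permP Nn') Et.
have es : (heap_size H' <= heap_size H)%N.
  by rewrite /heap_size (perm_size Nn) (perm_size Nn') /= leqnSn.
split; first by rewrite perm_sym; apply: (perm_trans Nn); rewrite perm_cons perm_sym.
rewrite !coreE !rpot_nil !deg_nil ew -/t !rpot2.
have -> : pot tmp (l1 ++ Node x k cs :: l2) =
    pot tmp l + spread (drop 2 (map (twt tmp) cs)).
  by rewrite /l !pot_cat pot_cons /level /=; lra.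
have -> : deg tmp (l1 ++ Node x k cs :: l2) = (deg tmp l + size cs)%N.
  by rewrite /l !deg_cat deg_cons /= tx; lia.
have e1 : (size l = size l1 + size cs + size l2)%N by rewrite /l !size_cat; lia.
have e2 : (size (l1 ++ Node x k cs :: l2) = (size l1 + size l2).+1)%N.
  by rewrite size_cat /=; lia.
have T := @llm_time_le l.
have L0 := @lgS_ge0 R t.
have Ls := @lgS_le R _ _ es.
have n1 : (npos tmp (llm v l) <= 1)%N by apply: leq_trans sr; exact: count_size.
have t0 : (0 < t)%N by rewrite Et.
have D := delete_step n1 t0.
have S1 : (size (llm v l))%:R <= 1 :> R by rewrite (ler_nat R _ 1).
have hk : (npos tmp l1 + npos tmp l2)%:R * lgS t <=
          (npos tmp (l1 ++ Node x k cs :: l2))%:R * lgS t :> R.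
  by rewrite ler_wpM2r // ler_nat npos_cat leq_add2l /npos /= leq_addl.
rewrite e1 !natrD in T; rewrite e2 natrD -[(_ + _).+1%:R]natr1 natrD.
rewrite -/l in hp; rewrite mul1r in D.
move: (lgS t.-1) D => L1 D.
rewrite /= ; lra.
Qed.

Lemma uniq_map_inj (S T : eqType) (f : S -> T) (s : seq S) :
  uniq (map f s) -> {in s &, injective f}.
Proof.
elim: s => //= z s IH /andP [zs us] p q; rewrite !in_cons.
move=> /orP [/eqP ->|ps] /orP [/eqP ->|qs] // e; last exact: IH.
- by move: zs; rewrite e map_f.
- by move: zs; rewrite -e map_f.
Qed.

(** The additional [lgS N] is for [d = 1] with [x] itself a root: the tree that takes its place is
    then measured at level 1, with one more child charged. *)
Lemma splice_rpot tmp x f d t l N : (d = 1 \/ d = 2)%N -> uniq (names l) ->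
  t \in all_subtrees l -> name t = x -> (size (f t) <= 1)%N -> (wt tmp (f t) <= twt tmp t)%N ->
  (wt tmp l <= N)%N ->
  rpot d tmp (splice x f l) + pot tmp [:: t] <= rpot d tmp l + pot tmp (f t) + lgS N.
Proof.
move=> d12 ul tl tx sf wf lN; have L0 := @lgS_ge0 R N.
have [[s1 _ _ _ _] S] := spliceP ul tl tx sf wf.
case: d12 => -> {d}; last by rewrite !rpot2; lra.
have [xl|xl] := boolP (x \in map name l); last by have := S xl 1%N; lra.
have [l1 [c [l2 [El Nc]]]] : exists l1 c l2, l = l1 ++ c :: l2 /\ name c = x.
  case/mapP: xl => c /path.splitPr [l1 l2] ->; by exists l1, c, l2.
have ct : c = t.
  apply: (uniq_map_inj ul) => //; last by rewrite Nc tx.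
  by rewrite -/(all_subtrees l) El all_subtrees_cat all_subtrees_cons mem_cat mem_head orbT.
rewrite El ct in ul lN *; rewrite (splice_root _ ul tx) !rpot_cat rpot_cons.
have h1 : pot tmp [:: t] <= level 1 tmp t + pot tmp (children t).
  by rewrite -rpot2 rpot_cons rpot_nil addr0 lerD2r;
     have := rpot_succ 1 tmp [:: t]; rewrite !rpot_cons !rpot_nil; lra.
have h2 : rpot 1 tmp (f t) <= pot tmp (f t) + lgS N.
  have : (wt tmp (f t) <= N)%N.
    by apply: leq_trans wf _; apply: leq_trans lN; rewrite wt_cat wt_cons; lia.
  case: (f t) sf => [|r [|//]] _; first by rewrite rpot_nil pot_nil; lra.
  move=> rN; rewrite -rpot2 !rpot_cons !rpot_nil.
  have := @spread_drop R 1 (map (twt tmp) (children r)); rewrite -!/(level _ tmp r).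
  have : lgS (sumn (map (twt tmp) (children r))) <= lgS N :> R.
    by rewrite lgS_le // sumn_twt (leq_trans _ rN) // -[leqRHS]/(twt tmp r) twtE leq_addl.
  lra.
lra.
Qed.

Lemma splice_rl_b tmp x f rl b t N : uniq (names (rl ++ b)) -> t \in all_subtrees (rl ++ b) ->
  name t = x -> (size (f t) <= 1)%N -> (wt tmp (f t) <= twt tmp t)%N ->
  (wt tmp (rl ++ b) <= N)%N ->
  [/\ perm_eq (names (splice x f rl ++ splice x f b) ++ names [:: t])
              (names (rl ++ b) ++ names (f t)),
    rpot 2 tmp (splice x f rl) + rpot 1 tmp (splice x f b) + pot tmp [:: t] <=
      rpot 2 tmp rl + rpot 1 tmp b + pot tmp (f t) + lgS N,
    (deg tmp (splice x f rl) + deg tmp (splice x f b) + deg tmp [:: t] <=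
      deg tmp rl + deg tmp b + deg tmp (f t))%N,
    (npos tmp (splice x f rl) <= npos tmp rl)%N &
    (size (splice x f rl) <= size rl)%N /\ (size (splice x f b) <= size b)%N].
Proof.
rewrite names_cat cat_uniq wt_cat => /and3P [url dis ub] tin tx sf wf wN.
have xd : x \in names rl -> x \in names b -> False.
  by move=> h1 h2; move/hasPn: dis => /(_ _ h2) /=; rewrite h1.
have wrl : (wt tmp rl <= N)%N := leq_trans (leq_addr _ _) wN.
have wb : (wt tmp b <= N)%N := leq_trans (leq_addl _ _) wN.
move: tin; rewrite all_subtrees_cat mem_cat => /orP [tin|tin].
- have bb : splice x f b = b.
    by apply: splice_notin; apply/negP => h; apply: xd h; rewrite -tx subtree_name.
  have [[_ s2 s3 s4 s5] _] := spliceP url tin tx sf wf.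
  have s6 := splice_rpot (or_intror erefl) url tin tx sf wf wrl.
  rewrite bb; split=> //.
  + apply/perm_countP => p; move/perm_countP: s3 => /(_ p).
    by rewrite !names_cat !count_cat; clear; lia.
  + by move: s6; clear; lra.
  + by rewrite addnAC [X in (_ <= X)%N]addnAC leq_add2r.
  + exact: shrunk_npos s4.
- have rr : splice x f rl = rl.
    by apply: splice_notin; apply/negP => h; apply: xd h _; rewrite -tx subtree_name.
  have [[_ s2 s3 s4 s5] _] := spliceP ub tin tx sf wf.
  have s6 := splice_rpot (or_introl erefl) ub tin tx sf wf wb.
  rewrite rr; split=> //.
  + apply/perm_countP => p; move/perm_countP: s3 => /(_ p).
    by rewrite !names_cat !count_cat; clear; lia.
  + by move: s6; clear; lra.
  + by rewrite -!addnA leq_add2l.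
Qed.

(** As for a root, the charge and the degree of [x] pay for linking its children; no list of roots
    grows, since at most one tree replaces [x]. *)
Lemma delete_other_core tmp v x (k : R) cs rl b : tmp x ->
  uniq (names (rl ++ b)) -> Node x k cs \in all_subtrees (rl ++ b) ->
  let f t := llm v (children t) in let H := Heap rl b in
  let H' := Heap (splice x f rl) (splice x f b) in
  [/\ perm_eq (x :: nodes H') (nodes H), (size (buffer H') <= size b)%N &
    llm_time cs + core tmp H' <= core tmp H + 64 * lgS (heap_wt tmp H) + 30].
Proof.
move=> tx uH tin f H H'; set t := Node x k cs in tin.
set N := heap_wt tmp H; have L0 := @lgS_ge0 R N.
have wN : wt tmp (rl ++ b) = N by [].
have wtN : (twt tmp t <= N)%N.
  (* Splicing out [t] altogether shows that the names in it are among those of the heap. *)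
  have [[_ _ /permP /(_ tmp)]] := @spliceP R tmp x (fun=> [::]) t _ uH tin erefl isT isT.
  rewrite !count_cat addn0 -[count _ (names [:: t])]/(twt tmp t) -[RHS]/(heap_wt tmp H) -/N; lia.
have wcs : (wt tmp ([::] ++ cs ++ [::]) <= N)%N.
  by rewrite cats0; apply: leq_trans wtN; rewrite twtE leq_addl.
have [sf nf hf] := pot_llm_le v wcs.
rewrite /= cats0 -[llm v cs]/(f t) in sf nf hf.
have wf : (wt tmp (f t) <= twt tmp t)%N.
  by rewrite /wt (permP nf) -[count _ _]/(wt tmp cs) twtE leq_addl.
have pt : pot tmp [:: t] = spread (drop 2 (map (twt tmp) cs)) + pot tmp cs.
  by rewrite pot_cons pot_nil addr0.
have dt : deg tmp [:: t] = (size cs + deg tmp cs)%N.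
  by rewrite deg_cons deg_nil /= tx mul1n addn0.
have ct p : count p (names [:: t]) = (p x + count p (names (f t)))%N.
  by rewrite names_cons cats0 /= (permP nf).
have [S0 S2 S3 S4 [S5 S6]] := splice_rl_b uH tin erefl sf wf (leqnn _).
have S1 : perm_eq (x :: names (splice x f rl ++ splice x f b)) (names (rl ++ b)).
  rewrite -(perm_cat2r (names (f t))); apply: perm_trans S0.
  rewrite names_cons cats0 /= perm_sym perm_catC /= perm_cons perm_catC perm_cat2l.
  by rewrite perm_sym.
rewrite wN in S2; split=> //.
have ew : heap_wt tmp H' = N.-1.
  by rewrite /N /heap_wt -(permP S1) /= tx.
have N0 : (0 < N)%N by rewrite /N /heap_wt -(permP S1) /= tx.
have es : (heap_size H' <= heap_size H)%N.
  by rewrite /heap_size -(perm_size S1) /= leqnSn.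
have Ls := @lgS_le R _ _ es.
have D := delete_step S4 N0.
have T := @llm_time_le cs.
have S3' : (deg tmp (splice x f rl))%:R + (deg tmp (splice x f b))%:R + (size cs)%:R +
   (deg tmp cs)%:R <= (deg tmp rl)%:R + (deg tmp b)%:R + (deg tmp (f t))%:R :> R.
  by rewrite -!natrD ler_nat -addnA -dt.
have S5' : (size (splice x f rl))%:R <= (size rl)%:R :> R by rewrite ler_nat.
have S6' : (size (splice x f b))%:R <= (size b)%:R :> R by rewrite ler_nat.
rewrite pt in S2; rewrite mul0r mulr0 addr0 in hf.
rewrite !coreE ew -/N.
move: (lgS N.-1) D => L1 D; lra.
Qed.

(** Since [lgS t <= 1 + lg t], the factor 95 is [64 + 31]. Here 64 covers the 52 of a root deletion
    with the 12 of emptying the buffer, and 31 includes the unit charged to every operation. *)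
Lemma lgS_amortized (t : nat) (y : R) : (0 < t)%N ->
  y <= 64 * lgS t + 31 -> y <= 95 * (1 + lg t%:R).
Proof.
move=> t0 h; have := lgS_lg (R := R) t0.
have : 0 <= lg t%:R :> R.
  have -> : 0 = lg (1 : R) by rewrite /lg ln1 mul0r.
  by apply: lg_le; rewrite // (ler_nat R 1).
lra.
Qed.

End Deletions.

(** * Amortized cost of the operations on heaps *)

Section OperationsOnHeaps.
Context {R : realType}.
Context (sort_time : nat -> R) (A K : R) (A0 : 0 <= A) (K0 : 0 <= K)
  (sort_time_le : forall m : nat, (0 < m)%N ->
     sort_time m <= K * m%:R + A * (m%:R * lgS m)).
Implicit Types (t u : tree R) (l rl b : seq (tree R)) (tmp : pred nat) (H : heap R)
  (v : variant).

(* Pays for sorting and linking a buffer of size [m]; the remaining [(A + 12) * m]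
   cover the [12 * lgS t] by which emptying it increases [core], since [lg n <= m]. *)
Definition bufpot (m : nat) : R := (K + A + 14) * m%:R + A * (m%:R * lgS m).

Definition hpot tmp H : R := core tmp H + bufpot (size (buffer H)).

Lemma bufpot0 : bufpot 0 = 0.
Proof. by rewrite /bufpot !mul0r !mulr0 addr0. Qed.

Lemma bufpot_le m n : (m <= n)%N -> bufpot m <= bufpot n.
Proof.
move=> mn; have mnR : m%:R <= n%:R :> R by rewrite ler_nat.
rewrite /bufpot lerD // ?ler_wpM2l //; first by have := A0; have := K0; lra.
by apply: ler_pM => //; [exact: lgS_ge0|exact: lgS_le].
Qed.

Lemma bufpot_ge0 m : 0 <= bufpot m.
Proof. by rewrite -bufpot0 bufpot_le. Qed.

(** The term [A * lgS m.+1] is the source of the double logarithm: while the buffer is kept, its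
    size is below [lg n]. *)
Lemma bufpotS m : bufpot m.+1 <= bufpot m + K + 3 * A + 14 + A * lgS m.+1.
Proof.
rewrite /bufpot; have := ler_wpM2l A0 (lgS_step (R := R) m).
rewrite !mulrDr -[X in (K + A + 14) * X]natr1 mulrDr mulr1; lra.
Qed.

Lemma heap_wt_le_size tmp H : (heap_wt tmp H <= heap_size H)%N.
Proof. exact: count_size. Qed.

(** The chain of links raises degrees by at most the number of roots that leave the buffer net of
    the new one, and passes level 1 charges on to level 2 unchanged. What remains is the charge of
    one more root, [4 * 3 = 12] logarithms. *)
Lemma flush_core tmp v rl b (s : seq (tree R)) r p : b <> [::] -> perm_eq s b ->
  sorted (fun t u => key u <= key t) s -> llm v s = [:: r] ->
  let H' := Heap (take p rl ++ r :: drop p rl) [::] in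
  perm_eq (nodes H') (nodes (Heap rl b)) /\
  core tmp H' <= core tmp (Heap rl b) + 12 * lgS (heap_wt tmp (Heap rl b)).
Proof.
move=> b0 sb so lr H'.
have [a [s' Es]] : exists (a : tree R) (s' : seq (tree R)), s = a :: s'.
  case: (s) sb => [|a s'] sb; last by exists a, s'.
  by case: b0; apply/perm_nilP; rewrite perm_sym.
rewrite Es in sb so lr.
have [r' [E Hn Hp]] := llm_sorted v so.
have Er : r' = r by move: lr; rewrite E => -[].
rewrite Er in Hn Hp => {r' Er E}; have {Hp} [Hp Hd] := Hp tmp.
have P : perm_eq (take p rl ++ r :: drop p rl) (r :: rl).
  by rewrite -{3}(cat_take_drop p rl) -(cat1s r) perm_catCA.
have Nn : perm_eq (nodes H') (nodes (Heap rl b)).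
  rewrite /H' /nodes /= cats0 (permPl (perm_names P)) names_cat perm_sym perm_catC.
  rewrite -(cat1s r rl) names_cat perm_cat2r perm_sym; apply: (perm_trans Hn).
  exact: perm_names.
split=> //.
rewrite /H' (core_perm _ _ P).
have ew : heap_wt tmp (Heap (r :: rl) [::]) = heap_wt tmp (Heap rl b).
  rewrite [RHS]/heap_wt -(permP Nn tmp) /heap_wt /nodes /= !cats0.
  by apply/permP; rewrite perm_sym; exact: perm_names.
have es : heap_size (Heap (r :: rl) [::]) = heap_size (Heap rl b).
  rewrite [RHS]/heap_size -(perm_size Nn) /heap_size /nodes /= !cats0.
  by apply: perm_size; rewrite perm_sym; exact: perm_names.
rewrite /core ew es /= rpot_cons rpot_nil deg_nil.
have L0 := @lgS_ge0 R (heap_wt tmp (Heap rl b)).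
have hr : pot tmp [:: r] = level 2 tmp r + pot tmp (children r).
  by rewrite pot_cons pot_nil addr0.
have hb : pot tmp [:: a] + rpot 1 tmp s' <= rpot 1 tmp b.
  by rewrite -(perm_rpot _ _ sb) rpot_cons lerD2r -rpot2 rpot_cons rpot_nil addr0;
    have := rpot_succ 1 tmp [:: a]; rewrite !rpot_cons !rpot_nil; lra.
have hd : (deg tmp (r :: rl))%:R + (size rl).+1%:R <=
    (deg tmp rl)%:R + (deg tmp b)%:R + (size rl)%:R + (size b)%:R :> R.
  rewrite -!natrD ler_nat -(cat1s r rl) deg_cat -(perm_deg _ sb) -(perm_size sb) /=.
  by move: Hd; clear; lia.
have hk : (npos tmp (r :: rl))%:R * lgS (heap_wt tmp (Heap rl b)) <=
   (npos tmp rl)%:R * lgS (heap_wt tmp (Heap rl b)) + lgS (heap_wt tmp (Heap rl b)) :> R.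
  rewrite -[X in _ + X]mul1r -mulrDl ler_wpM2r // natr1 ler_nat /=.
  by case: (0 < _)%N.
move: (lgS (heap_wt tmp (Heap rl b))) L0 hk => L L0 hk.
have Enp : npos tmp (r :: rl) = ((0 < twt tmp r)%N + npos tmp rl)%N by [].
rewrite Enp in hk; lra.
Qed.

(** Sorting and linking use up [bufpot] except for [A + 12] per root. This surplus is kept in the
    conclusion for decrease-key; the other operations can afford [flushP_le]. *)
Lemma flushP tmp v H H' c : empty_buffer sort_time v H H' c ->
  [/\ perm_eq (nodes H') (nodes H), buffer H' = [::] &
    hpot tmp H' + c <= hpot tmp H /\ size (buffer H) = 0%N \/
    hpot tmp H' + c + (A + 12) * (size (buffer H))%:R <=
      hpot tmp H + 12 * lgS (heap_wt tmp H)].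
Proof.
case=> {H H' c} [rl|rl b s r p b0 sb so lr _ _]; first by split=> //; left; rewrite addr0.
have [Hn Hc] := flush_core tmp rl p b0 sb so lr.
split=> //; right; rewrite /hpot /= bufpot0 addr0.
have m0 : (0 < size b)%N by case: (b) b0.
have := sort_time_le m0.
rewrite /llm_time (perm_size sb) /bufpot natrD.
have : (size b).-1%:R <= (size b)%:R :> R by rewrite ler_nat leq_pred.
move: Hc; rewrite /=.
move: (lgS (heap_wt _ _)) (core _ _) (core _ _) (lgS (size b)) => L c1 c2 L'; lra.
Qed.

Lemma flushP_le tmp v H H' c : empty_buffer sort_time v H H' c ->
  hpot tmp H' + c <= hpot tmp H + 12 * lgS (heap_wt tmp H).
Proof.
move=> /(flushP tmp) [_ _ [[h _]|h]].
  by have := @lgS_ge0 R (heap_wt tmp H); lra.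
have := mulr_ge0 A0 (ler0n R (size (buffer H))).
by have := ler0n R (size (buffer H)); lra.
Qed.

Lemma nodes_cons t rl b :
  nodes (Heap (t :: rl) b) = name t :: names (children t) ++ nodes (Heap rl b).
Proof. exact: names_cons. Qed.

(** A temporary new root raises the number of charged roots and that of temporary nodes alike, so
    [root_term_le] disposes of both terms. The 14 is 12 for the size of the heap and 2 for the
    root. *)
Lemma insertP tmp x (k : R) H : x \notin nodes H ->
  perm_eq (nodes (insert x k H)) (x :: nodes H) /\
  hpot tmp (insert x k H) <= hpot tmp H + 14.
Proof.
move=> xH; set t : tree R := Node x k [::].
have [rl [E P]] : exists rl, insert x k H = Heap rl (buffer H) /\ perm_eq rl (t :: roots H).
  exists (roots (insert x k H)); split=> //=; case: (roots H) => [|r rl] //.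
  by case: ifP => // _; apply/permPl; apply: (perm_catCA [:: r] [:: t]).
have Nn : perm_eq (nodes (insert x k H)) (x :: nodes H).
  rewrite E /nodes /=; apply: (@perm_trans _ (names ((t :: roots H) ++ buffer H))).
    by apply: perm_names; rewrite perm_cat2r.
  by rewrite cat_cons names_cons.
split=> //; rewrite /hpot E (core_perm _ _ P) /=.
suff : core tmp (Heap (t :: roots H) (buffer H)) <= core tmp H + 14 by lra.
have ew : heap_wt tmp (Heap (t :: roots H) (buffer H)) = (tmp x + heap_wt tmp H)%N.
  by rewrite /heap_wt nodes_cons; case: (H).
have es : heap_size (Heap (t :: roots H) (buffer H)) = (heap_size H).+1.
  by rewrite /heap_size nodes_cons; case: (H).
have et : (npos tmp (t :: roots H) = tmp x + npos tmp (roots H))%N.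
  by rewrite /npos /= twtE /= /wt /= addn0; case: (tmp x).
rewrite coreE ew es et rpot_cons deg_cons /= /level /= /core.
rewrite spread_nil pot_nil deg_nil.
have T := @root_term_le R _ _ (tmp x + heap_wt tmp H) (npos_le_heap_wt tmp H) (leq_addl _ _).
have L : lgS (heap_size H).+1 <= lgS (heap_size H) + 1 :> R.
  by rewrite -[X in _ <= _ + X]lgS1 -addn1 lgSD.
rewrite muln0 !add0n add0r -[(size (roots H)).+1%:R]natr1.
lra.
Qed.

(** The two size terms merge into one which, by [lgS_double], exceeds that of the larger heap by at
    most 12. The size term of the smaller heap is thus released and pays for emptying its buffer. *)
Lemma meld_core tmp v H H' H1 c rl : (heap_size H <= heap_size H')%N ->
  empty_buffer sort_time v H H1 c -> perm_eq rl (roots H1 ++ roots H') ->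
  let H'' := Heap rl (buffer H') in
  perm_eq (nodes H'') (nodes H ++ nodes H') /\
  c + hpot tmp H'' <= hpot tmp H + hpot tmp H' + 12.
Proof.
move=> le E P H''.
have [Nn B1 _] := flushP tmp E; have F := flushP_le tmp E.
have N2 : perm_eq (nodes H'') (nodes H1 ++ nodes H').
  rewrite /nodes /= B1 cats0 -names_cat catA; apply: perm_names.
  by rewrite perm_cat2r.
split; first by apply: (perm_trans N2); rewrite perm_cat2r.
have ew : heap_wt tmp H'' = (heap_wt tmp H1 + heap_wt tmp H')%N.
  by rewrite /heap_wt (permP N2) count_cat.
have es : heap_size H'' = (heap_size H1 + heap_size H')%N.
  by rewrite /heap_size (perm_size N2) size_cat.
have es1 : heap_size H1 = heap_size H by rewrite /heap_size (perm_size Nn).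
have T1 := @root_term_le R _ _ _ (npos_le_heap_wt tmp H1) (leq_addr (heap_wt tmp H') _).
have T2 := @root_term_le R _ _ _ (npos_le_heap_wt tmp H') (leq_addl (heap_wt tmp H1) _).
have D := @lgS_double R _ _ le.
have S : core tmp H'' <= core tmp H1 + core tmp H' - 12 * lgS (heap_size H) + 12.
  rewrite coreE ew es /core es1 B1 rpot_nil deg_nil.
  rewrite (perm_rpot _ _ P) (perm_npos _ P) (perm_deg _ P) (perm_size P).
  rewrite rpot_cat npos_cat deg_cat size_cat !natrD.
  move: T1 T2 D; rewrite /=; lra.
have : lgS (heap_wt tmp H) <= lgS (heap_size H) :> R by rewrite lgS_le // heap_wt_le_size.
move: F S; rewrite /hpot B1 bufpot0 addr0 /=; lra.
Qed.

Lemma meldP tmp v H H' H'' c : meld sort_time v H H' H'' c ->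
  perm_eq (nodes H'') (nodes H ++ nodes H') /\
  c + hpot tmp H'' <= hpot tmp H + hpot tmp H' + 12.
Proof.
case=> {H H' H'' c} H H' H1 c rl le E rlE _; apply: meld_core le E _.
by case: rlE => ->; rewrite // perm_catC.
Qed.

Lemma cut_hpot tmp x (k : R) H H' : uniq (nodes H) -> cut x k H H' ->
  perm_eq (nodes H') (nodes H) /\
  hpot tmp H' <= hpot tmp H + K + 3 * A + 16 + A * lgS (size (buffer H')).
Proof.
move=> uH /(cut_core tmp uH) [Nn Hc Hs]; split=> //.
suff : bufpot (size (buffer H')) <=
    bufpot (size (buffer H)) + K + 3 * A + 14 + A * lgS (size (buffer H')).
  by rewrite /hpot; lra.
have [le|lt] := leqP (size (buffer H')) (size (buffer H)).
  have := bufpot_le le; have := mulr_ge0 A0 (@lgS_ge0 R (size (buffer H'))).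
  by have := A0; have := K0; lra.
have -> : size (buffer H') = (size (buffer H)).+1 by apply/eqP; rewrite eqn_leq Hs lt.
exact: bufpotS.
Qed.

(** If the buffer is kept, its size [m] is below [lg n] and [lgS m] is at most [1 + lg (lg n)]. If
    it is emptied, [lg n <= m], and the surplus [(A + 12) * m] of [flushP] covers both the
    [12 * lgS t] of emptying and the [A * lgS m] of the last insertion into the buffer. *)
Lemma decrease_key_cost tmp v x (k M : R) H H1 H' c :
  1 <= M -> lg (lg (size (nodes H))%:R) <= M -> uniq (nodes H) -> cut x k H H1 ->
  ((size (buffer H1))%:R < lg (heap_size H1)%:R :> R) /\ H' = H1 /\ c = 0 \/
  (lg (heap_size H1)%:R <= (size (buffer H1))%:R :> R) /\
    empty_buffer sort_time v H1 H' c ->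
  perm_eq (nodes H') (nodes H) /\ 1 + c + hpot tmp H' <= hpot tmp H + (K + 5 * A + 30) * M.
Proof.
move=> M1 M2 uH C E; have [Nn Hp] := cut_hpot tmp uH C.
have KM : K <= K * M by rewrite ler_peMr.
have AM : A <= A * M by rewrite ler_peMr.
case: E => [[b [-> ->]]|[b E]].
  split=> //; have L : lgS (size (buffer H1)) <= 1 + M.
    have [->|b0] := posnP (size (buffer H1)); first by rewrite lgS0; lra.
    apply: (le_trans (lgS_lg b0)); rewrite lerD2l; apply: le_trans M2.
    by apply: lg_le; rewrite ?ltr0n // -(perm_size Nn) ltW.
  have := ler_wpM2l A0 L; rewrite mulrDr mulr1; lra.
have [Nn' _ Hf] := flushP tmp E.
split; first exact: perm_trans Nn' Nn.
case: Hf => [[Hf b0]|Hf].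
  by rewrite b0 lgS0 mulr0 in Hp; have := A0; lra.
have L1 : lgS (heap_wt tmp H1) <= 1 + (size (buffer H1))%:R :> R.
  apply: (@le_trans _ _ (lgS (heap_size H1))); first by rewrite lgS_le // heap_wt_le_size.
  have [->|n0] := posnP (heap_size H1); first by rewrite lgS0 addr_ge0.
  by apply: (le_trans (lgS_lg n0)); rewrite lerD2l.
have := ler_wpM2l A0 (lgS_le_id (R := R) (size (buffer H1))); have := A0; lra.
Qed.

Lemma decrease_keyP tmp v x (k : R) H H' c : uniq (nodes H) ->
  decrease_key sort_time v x k H H' c ->
  perm_eq (nodes H') (nodes H) /\
  1 + c + hpot tmp H' <= hpot tmp H +
    (K + 5 * A + 30) * Num.max 1 (lg (lg (size (nodes H))%:R)).
Proof.
move=> uH D; have M1 : 1 <= Num.max 1 (lg (lg (size (nodes H))%:R)) :> R by rewrite le_max lexx.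
have M2 : lg (lg (size (nodes H))%:R) <= Num.max 1 (lg (lg (size (nodes H))%:R)) :> R.
  by rewrite le_max lexx orbT.
case: D uH M1 M2 => {H H' c} [H H1 C b|H H1 H' c C b E] uH M1 M2.
  by apply: (@decrease_key_cost tmp v x k _ H H1 H1 0) => //; left.
by apply: (@decrease_key_cost tmp v x k _ H H1 H' c) => //; right.
Qed.

Lemma delete_root_cost tmp v x (k : R) l1 cs l2 H c : tmp x ->
  empty_buffer sort_time v H (Heap (l1 ++ Node x k cs :: l2) [::]) c ->
  let l := l1 ++ cs ++ l2 in let H' := Heap (llm v l) [::] in
  perm_eq (x :: nodes H') (nodes H) /\
  1 + (c + llm_time l) + hpot tmp H' <= hpot tmp H + 95 * (1 + lg (heap_wt tmp H)%:R).
Proof.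
move=> tx E l H'; have [Nn _ _] := flushP tmp E; have F := flushP_le tmp E.
have [Nn' C] := @delete_root_core R tmp v x k l1 cs l2 tx.
have PN : perm_eq (x :: nodes H') (nodes H) := perm_trans Nn' Nn.
split=> //; have ew : heap_wt tmp (Heap (l1 ++ Node x k cs :: l2) [::]) = heap_wt tmp H.
  by rewrite /heap_wt (permP Nn).
have t0 : (0 < heap_wt tmp H)%N by rewrite /heap_wt -(permP PN) /= tx.
rewrite -lerBlDl; apply: (lgS_amortized t0).
rewrite ew -/l -/H' in C.
have B1 : hpot tmp (Heap (l1 ++ Node x k cs :: l2) [::]) =
          core tmp (Heap (l1 ++ Node x k cs :: l2) [::]) by rewrite /hpot bufpot0 addr0.
have B2 : hpot tmp H' = core tmp H' by rewrite /hpot bufpot0 addr0.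
by rewrite B1 in F; rewrite B2; lra.
Qed.

Lemma delete_minP tmp v x H H' c : tmp x -> delete_min sort_time v x H H' c ->
  perm_eq (x :: nodes H') (nodes H) /\
  1 + c + hpot tmp H' <= hpot tmp H + 95 * (1 + lg (heap_wt tmp H)%:R).
Proof.
move=> tx D; case: D tx => {H H' c x} H c x k cs l E tx.
exact: (@delete_root_cost tmp v x k [::] cs l H c tx E).
Qed.

Lemma delete_other_cost tmp v x (k : R) cs rl b : tmp x ->
  uniq (names (rl ++ b)) -> Node x k cs \in all_subtrees (rl ++ b) ->
  let f t := llm v (children t) in let H := Heap rl b in
  let H' := Heap (splice x f rl) (splice x f b) in
  perm_eq (x :: nodes H') (nodes H) /\
  1 + llm_time cs + hpot tmp H' <= hpot tmp H + 95 * (1 + lg (heap_wt tmp H)%:R).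
Proof.
move=> tx uH tin f H H'; have [Nn Hs Hc] := delete_other_core v tx uH tin.
split=> //.
have t0 : (0 < heap_wt tmp H)%N by rewrite /heap_wt -(permP Nn) /= tx.
rewrite -lerBlDl; apply: (lgS_amortized t0).
have := bufpot_le Hs; rewrite -/f -/H -/H' in Hc; rewrite /hpot /= -/H -/H'; lra.
Qed.

Lemma deleteP tmp v x H H' c : tmp x -> uniq (nodes H) -> delete sort_time v x H H' c ->
  perm_eq (x :: nodes H') (nodes H) /\
  1 + c + hpot tmp H' <= hpot tmp H + 95 * (1 + lg (heap_wt tmp H)%:R).
Proof.
move=> tx uH D; case: D uH => {H H' c} [H H' c _ D|rl b k cs _ tin] uH.
  by case: D uH => {}H {}c l1 k cs l2 E uH; exact: (@delete_root_cost tmp v x k l1 cs l2 H c tx E).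
exact: (@delete_other_cost tmp v x k cs rl b tx uH tin).
Qed.

(** The only negative term vanishes with the number of temporary nodes. *)
Lemma hpot_ge0 tmp H : heap_wt tmp H = 0%N -> 0 <= hpot tmp H.
Proof.
move=> w0; rewrite /hpot /core w0 lgS0.
have := @rpot_ge0 R 2 tmp (roots H); have := @rpot_ge0 R 1 tmp (buffer H).
have := bufpot_ge0 (size (buffer H)); have := @lgS_ge0 R (heap_size H).
have h (n : nat) : 0 <= n%:R :> R by [].
have := h (deg tmp (roots H)); have := h (deg tmp (buffer H)).
have := h (size (roots H)); have := h (size (buffer H)).
rewrite !mulr0; lra.
Qed.

Lemma hpot_empty tmp : hpot tmp (empty_heap R) = 0.
Proof.
rewrite /hpot bufpot0 /core /heap_wt /heap_size /= lgS0 !rpot_nil !deg_nil !mulr0n /=; lra.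
Qed.

(** * Potential of a state and induction over an execution *)

Implicit Types (st : state R).

Definition op_bound (o : operation R) : nat :=
  match o with
  | MakeHeap h | FindMin h | Insert _ _ h | DeleteMin h | DecreaseKey _ _ h | Delete _ h => h
  | Meld_into h h' => maxn h h'
  end.

Definition opt_pot tmp (oH : option (heap R)) : R := if oH is Some H then hpot tmp H else 0.

(** Heaps are designated by arbitrary numbers; [N] bounds those that a finite execution mentions, so
    that the sum is finite. *)
Definition state_pot tmp N st : R := \sum_(h < N) opt_pot tmp (heaps st h).

Lemma state_pot_set tmp N st h oH : (h < N)%N ->
  state_pot tmp N (set_heap st h oH) =
    state_pot tmp N st - opt_pot tmp (heaps st h) + opt_pot tmp oH.
Proof.
move=> hN; rewrite /state_pot (bigD1 (Ordinal hN)) //= [in RHS](bigD1 (Ordinal hN)) //= eqxx.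
rewrite [X in _ + X = _](eq_bigr (fun i : 'I_N => opt_pot tmp (heaps st i))); first lra.
by move=> i ih; case: eqP => // e; move: ih; rewrite -val_eqE /= e eqxx.
Qed.

Lemma nodes_of_set st h oH h0 : nodes_of (set_heap st h oH) h0 =
  if h0 == h then (if oH is Some H then nodes H else [::]) else nodes_of st h0.
Proof. by rewrite /nodes_of /=; case: eqP. Qed.

Definition wf_state st : Prop :=
  [/\ forall h, uniq (nodes_of st h),
      forall h h' x, x \in nodes_of st h -> x \in nodes_of st h' -> h = h' &
      forall h x, x \in nodes_of st h -> x \in used st].

(** Ensures that a deleted node, which remains in [used], never reappears in a heap. *)
Definition no_revival st st' : Prop :=
  {subset used st <= used st'} /\
  forall h x, x \in nodes_of st' h -> (exists h0, x \in nodes_of st h0) \/ x \notin used st.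

Lemma wf_step st st' h : wf_state st -> uniq (nodes_of st' h) ->
  {subset used st <= used st'} ->
  (forall h0, h0 <> h -> nodes_of st' h0 = nodes_of st h0 \/ nodes_of st' h0 = [::]) ->
  (forall x, x \in nodes_of st' h -> x \in used st' /\
     (x \notin used st \/ exists h1, x \in nodes_of st h1 /\
        (h1 = h \/ nodes_of st' h1 = [::]))) ->
  wf_state st' /\ no_revival st st'.
Proof.
move=> [u d s] uh us ne eq.
have sub h0 x : h0 <> h -> x \in nodes_of st' h0 -> x \in nodes_of st h0.
  by move=> /ne [->|->].
have dis h0 x : h0 <> h -> x \in nodes_of st' h -> x \in nodes_of st' h0 -> False.
  move=> n /eq [_ [xu|[h1 [x1 h1E]]]] x0; first by move: xu; rewrite (s _ _ (sub _ _ n x0)).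
  have e := d _ _ _ x1 (sub _ _ n x0).
  case: h1E => [h1E|E]; first by apply: n; rewrite -e.
  by move: x0; rewrite -e E.
split; last first.
  split=> // h0 x x0; have [e|/eqP n] := eqVneq h0 h; last by left; exists h0; apply: sub n x0.
  by move: x0; rewrite e => /eq [_ [xu|[h1 [x1 _]]]]; [right|left; exists h1].
split.
- by move=> h0; have [->//|/eqP n] := eqVneq h0 h; case: (ne _ n) => ->.
- move=> h0 h1 x; have [->|/eqP n0] := eqVneq h0 h; have [->|/eqP n1] := eqVneq h1 h => //.
  + by move=> x0 x1; case: (dis _ _ n1 x0 x1).
  + by move=> x0 x1; case: (dis _ _ n0 x1 x0).
  + by move=> /(sub _ _ n0) x0 /(sub _ _ n1); apply: d.
- move=> h0 x; have [->|/eqP n] := eqVneq h0 h; first by case/eq.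
  by move=> /(sub _ _ n) /s /us.
Qed.

Lemma wf_set st h H H' : wf_state st -> heaps st h = Some H -> uniq (nodes H') ->
  {subset nodes H' <= nodes H} ->
  wf_state (set_heap st h (Some H')) /\ no_revival st (set_heap st h (Some H')).
Proof.
move=> W E u s; have nh : nodes_of st h = nodes H by rewrite /nodes_of E.
have [_ _ su] := W.
apply: (@wf_step _ _ h W) => //.
- by rewrite nodes_of_set eqxx.
- by move=> h0 /eqP n; left; rewrite nodes_of_set (negbTE n).
- move=> x; rewrite nodes_of_set eqxx => /s xH; split; first by apply: (su h); rewrite nh.
  by right; exists h; rewrite nh; split=> //; left.
Qed.

(** The amortized bound for a fixed set [tmp], independent of the rest of the execution; [run_bound]
    compares it with [amortized]. *)
Definition op_cost tmp st (o : operation R) : R :=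
  match o with
  | DeleteMin h | Delete _ h => 1 + lg (count tmp (nodes_of st h))%:R
  | DecreaseKey _ _ h => Num.max 1 (lg (lg (size (nodes_of st h))%:R))
  | MakeHeap _ | FindMin _ | Insert _ _ _ | Meld_into _ _ => 1
  end.

Lemma op_cost_ge1 tmp st o : 1 <= op_cost tmp st o.
Proof. by case: o => //= *; rewrite ?le_max ?lexx // lerDl lg_nat_ge0. Qed.

Definition op_factor : R := K + 5 * A + 100.

Lemma op_factor_ge tmp st o (B : R) : B <= op_factor ->
  B * op_cost tmp st o <= op_factor * op_cost tmp st o.
Proof. by move=> h; rewrite ler_wpM2r // (le_trans ler01) // op_cost_ge1. Qed.

Lemma op_factor_ge100 : K + 5 * A + 30 <= op_factor /\ 100 <= op_factor.
Proof. by rewrite /op_factor; have := A0; have := K0; split; lra. Qed.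

Definition step_ok tmp N st (o : operation R) (d : option nat) (c : R) st' : Prop :=
  [/\ wf_state st', no_revival st st',
      forall x, d = Some x -> x \in used st' /\ forall h, x \notin nodes_of st' h &
      c + state_pot tmp N st' <= state_pot tmp N st + op_factor * op_cost tmp st o].

Lemma step_ok_make tmp N st h : wf_state st -> (h < N)%N -> heaps st h = None ->
  step_ok tmp N st (MakeHeap h) None 1 (set_heap st h (Some (empty_heap R))).
Proof.
move=> W hN E; have [_ F] := op_factor_ge100.
have [W' NR] : wf_state (set_heap st h (Some (empty_heap R))) /\
    no_revival st (set_heap st h (Some (empty_heap R))).
  apply: (@wf_step _ _ h W) => //.
  + by rewrite nodes_of_set eqxx.
  + by move=> h0 /eqP n; left; rewrite nodes_of_set (negbTE n).
  + by move=> x; rewrite nodes_of_set eqxx.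
by split=> //; rewrite state_pot_set // E /= hpot_empty mulr1; lra.
Qed.

Lemma step_ok_insert tmp N st x (k : R) h H : wf_state st -> (h < N)%N ->
  heaps st h = Some H -> x \notin used st ->
  step_ok tmp N st (Insert x k h) None 1
    (State (heaps (set_heap st h (Some (insert x k H)))) (x :: used st)).
Proof.
move=> W hN E xu; have [_ F] := op_factor_ge100.
have [u _ su] := W; have nh : nodes_of st h = nodes H by rewrite /nodes_of E.
have xH : x \notin nodes H by apply: contra xu; rewrite -nh; apply: su.
have [Nn Hp] := insertP tmp k xH.
set st' := State _ _.
have nst' h0 : nodes_of st' h0 = nodes_of (set_heap st h (Some (insert x k H))) h0 by [].
have [W' NR] : wf_state st' /\ no_revival st st'.
  apply: (@wf_step _ _ h W) => //.
  + by rewrite nst' nodes_of_set eqxx (perm_uniq Nn) /= xH -nh u.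
  + by move=> y yu; rewrite /= in_cons yu orbT.
  + by move=> h0 /eqP n; left; rewrite nst' nodes_of_set (negbTE n).
  + move=> y; rewrite nst' nodes_of_set eqxx (perm_mem Nn) in_cons => /orP [/eqP ->|yH].
      by rewrite mem_head; split=> //; left.
    split; first by rewrite /= in_cons (su h) ?orbT // nh.
    by right; exists h; rewrite nh; split=> //; left.
split=> //; have -> : state_pot tmp N st' =
    state_pot tmp N (set_heap st h (Some (insert x k H))) by [].
by rewrite state_pot_set // E /= mulr1; move: Hp F; move: (op_factor) => C; lra.
Qed.

Lemma step_ok_meld tmp v N st h h' H H' H'' c : wf_state st -> (maxn h h' < N)%N ->
  h <> h' -> heaps st h = Some H -> heaps st h' = Some H' ->
  meld sort_time v H H' H'' c \/ meld sort_time v H' H H'' c ->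
  step_ok tmp N st (Meld_into h h') None (1 + c)
    (set_heap (set_heap st h' None) h (Some H'')).
Proof.
move=> W + hh E E' M; rewrite gtn_max => /andP [hN hN'].
have [_ F] := op_factor_ge100; have [u dis su] := W.
have nh : nodes_of st h = nodes H by rewrite /nodes_of E.
have nh' : nodes_of st h' = nodes H' by rewrite /nodes_of E'.
have [Nn Hp] : perm_eq (nodes H'') (nodes H ++ nodes H') /\
    c + hpot tmp H'' <= hpot tmp H + hpot tmp H' + 12.
  case: M => /(meldP tmp) [Nn Hp]; split=> //; last by rewrite [hpot tmp H + _]addrC.
  by apply: (perm_trans Nn); rewrite perm_catC.
set st' := set_heap _ _ _.
have nst' h0 : nodes_of st' h0 =
    if h0 == h then nodes H'' else if h0 == h' then [::] else nodes_of st h0.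
  by rewrite !nodes_of_set.
have [W' NR] : wf_state st' /\ no_revival st st'.
  apply: (@wf_step _ _ h W) => //.
  + rewrite nst' eqxx (perm_uniq Nn) cat_uniq -nh -nh' !u andbT /=.
    by apply/hasPn => x x'; apply/negP => x0; apply: hh; apply: dis x0 x'.
  + by move=> h0 /eqP n; rewrite nst' (negbTE n); case: eqP => _; [right|left].
  + move=> x; rewrite nst' eqxx (perm_mem Nn) mem_cat => /orP [x0|x0].
      split; first by apply: (su h); rewrite nh.
      by right; exists h; rewrite nh; split=> //; left.
    split; first by apply: (su h'); rewrite nh'.
    right; exists h'; rewrite nh'; split=> //; right; rewrite nst' eqxx.
    by case: eqP hh => // ->.
split=> //; rewrite /st' !state_pot_set // E' /=.
have -> : (h == h') = false by apply/eqP.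
by rewrite E /= mulr1; move: Hp F; move: (op_factor) => C; lra.
Qed.

Lemma step_ok_delete tmp N st (o : operation R) x h H H' c : wf_state st -> (h < N)%N ->
  heaps st h = Some H -> op_cost tmp st o = 1 + lg (count tmp (nodes H))%:R ->
  perm_eq (x :: nodes H') (nodes H) /\
  1 + c + hpot tmp H' <= hpot tmp H + 95 * (1 + lg (heap_wt tmp H)%:R) ->
  step_ok tmp N st o (Some x) (1 + c) (set_heap st h (Some H')).
Proof.
move=> W hN E co [Nn Hp]; have [_ F] := op_factor_ge100.
have nh : nodes_of st h = nodes H by rewrite /nodes_of E.
have [u dis su] := W; have := u h; rewrite nh -(perm_uniq Nn) /= => /andP [xH' uH'].
have sH y : y \in nodes H' -> y \in nodes H by rewrite -(perm_mem Nn) in_cons => ->; rewrite orbT.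
have [W' NR] := wf_set W E uH' sH.
have xh : x \in nodes_of st h by rewrite nh -(perm_mem Nn) mem_head.
split=> //.
  move=> _ [<-]; split; first exact: su xh.
  move=> h0; rewrite nodes_of_set; case: eqP => // n; apply/negP => x0.
  by apply: n; apply: dis x0 xh.
have F' : 95 <= op_factor by apply: le_trans F; rewrite ler_nat.
have C1 := @op_factor_ge tmp st o _ F'.
rewrite state_pot_set // E /= co in C1 *; rewrite /heap_wt in Hp.
by move: Hp C1; move: (op_factor * _) => C; lra.
Qed.

Lemma step_ok_decrease_key tmp v N st x (k : R) h H H' c : wf_state st -> (h < N)%N ->
  heaps st h = Some H -> decrease_key sort_time v x k H H' c ->
  step_ok tmp N st (DecreaseKey x k h) None (1 + c) (set_heap st h (Some H')).
Proof.
move=> W hN E D; have [F _] := op_factor_ge100.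
have nh : nodes_of st h = nodes H by rewrite /nodes_of E.
have [u dis su] := W; have uH : uniq (nodes H) by rewrite -nh.
have [Nn Hp] := decrease_keyP tmp uH D.
have [W' NR] : wf_state (set_heap st h (Some H')) /\ no_revival st (set_heap st h (Some H')).
  by apply: (wf_set W E); [rewrite (perm_uniq Nn)|move=> y; rewrite (perm_mem Nn)].
have C1 := @op_factor_ge tmp st (DecreaseKey x k h) _ F.
split=> //; rewrite state_pot_set // E /= nh in C1 *.
by move: Hp C1; move: (op_factor * _) ((K + _ + _) * _) => C C'; lra.
Qed.

Lemma stepP tmp v N st o d c st' : wf_state st -> (op_bound o < N)%N ->
  (forall x, d = Some x -> tmp x) -> step sort_time v st o d c st' ->
  step_ok tmp N st o d c st'.
Proof.
move=> W oN dt S; case: S oN dt => {o d c st'}.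
- by move=> h E oN _; exact: step_ok_make.
- move=> h H E oN _; have [_ F] := op_factor_ge100; split=> //; last first.
    by rewrite /= mulr1; move: F; move: (op_factor) => C; lra.
  by split=> // h0 x x0; left; exists h0.
- by move=> x k h H E xu oN _; exact: step_ok_insert.
- by move=> h h' H H' H'' c hh E E' M oN _; exact: step_ok_meld hh E E' M.
- move=> h H x H' c E D oN /(_ x erefl) tx.
  apply: (step_ok_delete W oN E _ (delete_minP tx D)).
  by rewrite /= /nodes_of E.
- by move=> x k h H H' c E D oN _; exact: step_ok_decrease_key E D.
- move=> x h H H' c E D oN /(_ x erefl) tx.
  have uH : uniq (nodes H) by have [u _ _] := W; have := u h; rewrite /nodes_of E.
  apply: (step_ok_delete W oN E _ (deleteP tx uH D)).
  by rewrite /= /nodes_of E.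
Qed.

Lemma sub_in_count (T : eqType) (a1 a2 : pred T) (s : seq T) :
  {in s, forall x, a1 x -> a2 x} -> (count a1 s <= count a2 s)%N.
Proof.
elim: s => //= y s IH h; apply: leq_add; last first.
  by apply: IH => x xs; apply: h; rewrite in_cons xs orbT.
by case: (a1 y) (h y (mem_head _ _)) => // ->.
Qed.

(** [D] stands for the nodes deleted in the whole execution and stays fixed, so that the potential
    does not jump between operations. Its members deleted so far lie in no heap, hence inside every
    heap it agrees with the current temporary nodes. At the end no member of [D] is left in a heap
    and the potential is nonnegative. *)
Lemma run_bound (D : seq nat) v N st es : run sort_time v st es -> wf_state st ->
  all (fun e => op_bound (op e) < N)%N es ->
  {subset pmap (@deleted R) es <= D} ->
  (forall x, x \in D -> x \in pmap (@deleted R) es \/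
     x \in used st /\ forall h, x \notin nodes_of st h) ->
  total_time es <= op_factor * total_amortized es + state_pot (mem D) N st.
Proof.
elim=> {st es} [st|st o d c st' es S _ IH] W.
  move=> _ _ DS; rewrite /total_time big_nil mulr0 add0r sumr_ge0 // => h _.
  rewrite /opt_pot; case E: (heaps st h) => [H|//]; apply: hpot_ge0.
  apply/eqP; rewrite -leqn0 leqNgt -has_count; apply/hasPn => x xH.
  apply/negP => /DS [//|[_ /(_ h)]].
  by rewrite /nodes_of E xH.
move=> /= /andP [oN aN] sD DS.
have dD x : d = Some x -> x \in D by move=> e; apply: sD; rewrite /= e /= mem_head.
have [W' [us NR] dx P] := stepP W oN dD S.
rewrite /total_time big_cons /= mulrDr -/(total_time es).
have sD' : {subset pmap (@deleted R) es <= D}.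
  by move=> x xd; apply: sD; rewrite /=; case: (d) => //= y; rewrite in_cons xd orbT.
have DS' x : x \in D -> x \in pmap (@deleted R) es \/
    x \in used st' /\ forall h, x \notin nodes_of st' h.
  move=> /DS [|[xu xn]]; last first.
    right; split; first exact: us.
    by move=> h; apply/negP => /NR [[h0]|]; rewrite ?xu //; apply/negP.
  rewrite /=; case: (d) dx => [y|] dx /=; last by left.
  rewrite in_cons => /orP [/eqP ->|]; last by left.
  by right; apply: dx.
have {}IH := IH W' aN sD' DS'.
have am : op_cost (mem D) st o <= amortized (Event st o d c) es.
  have T h : (count (mem D) (nodes_of st h) <=
      temporaries st h (Event st o d c :: es))%N.
    rewrite /temporaries; apply: sub_in_count => x xh /DS [//|[_ /(_ h)]].
    by rewrite xh.
  by case: (o) => //= *; rewrite lerD2l lg_nat_le.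
have f0 : 0 <= op_factor by have [_] := op_factor_ge100; apply: le_trans.
have := ler_wpM2l f0 am; move: P IH; clear.
by move: (op_factor * _) (op_factor * _) (op_factor * _) => a1 a2 a3; lra.
Qed.

End OperationsOnHeaps.

Theorem theorem2 (R : realType) (sort_time : nat -> R) (A : R)
    (sort_time_le : forall m : nat, (1 < m)%N ->
       sort_time m <= A * (m%:R * lg m%:R)) :
  exists C : R, forall (v : variant) (es : seq (event R)),
    run sort_time v (no_heaps R) es ->
    total_time es <= C * total_amortized es.
Proof.
pose A' := `|A|; pose K := `|sort_time 1|.
(* The assumption on sorting starts at two roots; the linear term [K] takes care of a buffer with a
   single root. *)
have h m : (0 < m)%N -> sort_time m <= K * m%:R + A' * (m%:R * lgS m).
  case: m => [//|[|m]] _.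
    by rewrite lgS1 !mulr1 (le_trans (ler_norm _)) // /K lerDl normr_ge0.
  apply: (le_trans (sort_time_le m.+2 isT)).
  have l0 := lg_nat_ge0 (R := R) m.+2; have l1 := lg_le_lgS (R := R) m.+2.
  have a1 : A * (m.+2%:R * lg m.+2%:R) <= A' * (m.+2%:R * lg m.+2%:R).
    by apply: ler_wpM2r; [exact: mulr_ge0|exact: ler_norm].
  have a2 : A' * (m.+2%:R * lg m.+2%:R) <= A' * (m.+2%:R * lgS m.+2).
    by apply: ler_wpM2l; [exact: normr_ge0|exact: ler_wpM2l].
  by apply: le_trans a1 (le_trans a2 _); rewrite lerDr mulr_ge0 // normr_ge0.
(* The constant depends on the sorting time alone, neither on the variant nor on the execution. *)
exists (op_factor A' K) => v es E.
pose N := (\max_(e <- es) op_bound (op e)).+1.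
have aN : all (fun e => op_bound (op e) < N)%N es.
  rewrite /N; elim: (es) => //= e es' IH; rewrite big_cons ltnS leq_maxl /=.
  by apply: sub_all IH => e' /=; rewrite !ltnS => l; rewrite (leq_trans l) // leq_maxr.
have W : wf_state (no_heaps R) by split.
have := @run_bound _ sort_time A' K (normr_ge0 _) (normr_ge0 _) h (pmap (@deleted R) es)
  v N _ es E W aN (fun x => id) (fun x => @or_introl _ _).
by rewrite /state_pot /= big1 ?addr0.
Qed.
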